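(* Let $V$ be a set of $n$ i.i.d. uniform random points in $[0,1]^2$, let $k$ be any integer in $[1,n]$, and let the depot $O$ be any fixed point of $\mathbb{R}^2$. For any constant $\alpha\ge 1$ and any $\alpha$-approximate traveling salesman tour $T$ on $V\cup\{O\}$, asymptotically almost surely $$\frac{\mathrm{ITP}(T)}{\mathrm{OPT}}\ \le\ 0.915+\alpha .$$
   Context: Unit-demand Euclidean capacitated vehicle routing problem (CVRP): given a set $V$ of $n$ customer points in $\mathbb{R}^2$, a depot $O\in\mathbb{R}^2$ and an integer capacity $k\in[1,n]$, find a collection of tours, each starting and ending at $O$ and visiting at most $k$ points of $V$, covering all of $V$, of minimum total Euclidean length; $\mathrm{OPT}$ denotes this minimum. A traveling salesman tour $T$ on $V\cup\{O\}$ is $\alpha$-approximate if its cost is at most $\alpha$ times the cost of an optimal traveling salesman tour on $V\cup\{O\}$. Iterated tour partitioning (ITP): write $T=(O,x_1,\dots,x_n,O)$. For each $i\in\{1,\dots,k\}$ let $n_i=\lceil (n-i)/k\rceil+1$ and let $S_i$ consist of the tours $(O,x_1,\dots,x_i,O)$, $(O,x_{i+1},\dots,x_{i+k},O)$, $\dots$, $(O,x_{i+(n_i-2)k+1},\dots,x_n,O)$. Then $\mathrm{ITP}(T)=\min_{1\le i\le k}\mathrm{cost}(S_i)$. An event occurs asymptotically almost surely (a.a.s.) if its probability tends to $1$ as $n\to\infty$. *)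

(* Defs.v *)
From HB Require Import structures.
From mathcomp Require Import all_boot all_order all_algebra.
From mathcomp Require Import all_classical all_reals all_analysis.
From mathcomp Require Import fingroup perm.
Set Implicit Arguments. Unset Strict Implicit. Unset Printing Implicit Defensive.
Import Order.TTheory GRing.Theory Num.Theory.
Import numFieldNormedType.Exports.
Local Open Scope classical_set_scope.
Local Open Scope ring_scope.

Section Routing.
Variable R : realType.

Definition pt := (R * R)%type.

Definition edist (x y : pt) : R :=
  Num.sqrt ((x.1 - y.1) ^+ 2 + (x.2 - y.2) ^+ 2).

Fixpoint pathlen (x : pt) (s : seq pt) : R :=
  match s with
  | [::] => 0
  | y :: s' => edist x y + pathlen y s'
  end.

Definition route_cost (O : pt) (s : seq pt) : R := pathlen O (rcons s O).

Definition routes_cost (O : pt) (S : seq (seq pt)) : R :=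
  \sum_(t <- S) route_cost O t.

Variable n : nat.

Definition tour_seq (V : 'I_n -> pt) (T : {perm 'I_n}) : seq pt :=
  [seq V (T i) | i <- enum 'I_n].

Definition tsp_cost (O : pt) (V : 'I_n -> pt) (T : {perm 'I_n}) : R :=
  route_cost O (tour_seq V T).

Definition tsp_opt (O : pt) (V : 'I_n -> pt) : R :=
  \big[Num.min/tsp_cost O V 1]_(T : {perm 'I_n}) tsp_cost O V T.

Definition alpha_approx (alpha : R) (O : pt) (V : 'I_n -> pt)
    (T : {perm 'I_n}) : Prop :=
  tsp_cost O V T <= alpha * tsp_opt O V.

(* OPT: minimum total length of a collection of tours from O, each visiting
   at most k points of V, covering all of V (given as an infimum over all
   feasible solutions; it is attained) *)
Definition cvrp_opt (O : pt) (V : 'I_n -> pt) (k : nat) : R :=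
  inf [set c : R | exists tours : seq (seq 'I_n),
        [/\ (forall t, t \in tours -> size (undup t) <= k)%N,
            (forall i : 'I_n, exists2 t, t \in tours & i \in t) &
            c = \sum_(t <- tours) route_cost O [seq V j | j <- t]]].

End Routing.

(* splitting a sequence into consecutive blocks of k elements
   (the last block may be shorter); fuel = size s suffices for k >= 1 *)
Fixpoint chunks (T : Type) (fuel k : nat) (s : seq T) : seq (seq T) :=
  match fuel with
  | 0 => [::]
  | f.+1 => if s is [::] then [::] else take k s :: chunks f k (drop k s)
  end.

Section ITP.
Variable R : realType.
Variable n : nat.

Definition itp_solution (k i : nat) (xs : seq (pt R)) : seq (seq (pt R)) :=
  take i xs :: chunks (size xs) k (drop i xs).

Definition itp_cost_i (O : pt R) (V : 'I_n -> pt R) (k : nat)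
    (T : {perm 'I_n}) (i : nat) : R :=
  routes_cost O (itp_solution k i (tour_seq V T)).

Definition ITP (O : pt R) (V : 'I_n -> pt R) (k : nat) (T : {perm 'I_n}) : R :=
  \big[Num.min/itp_cost_i O V k T 1]_(1 <= i < k.+1) itp_cost_i O V k T i.

End ITP.

Definition mutually_independent {d} {Omega : measurableType d} {R : realType}
    (P : probability Omega R) (U : nat -> Omega -> R) : Prop :=
  forall (J : seq nat) (B : nat -> set R),
    uniq J -> (forall j, j \in J -> measurable (B j)) ->
    P (\bigcap_(j in [set` J]) (U j @^-1` B j)) =
    (\prod_(j <- J) P (U j @^-1` B j))%E.

Definition uniform01 {d} {Omega : measurableType d} {R : realType}
    (P : probability Omega R) (X : Omega -> R) : Prop :=
  measurable_fun setT X /\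
  forall B : set R, measurable B ->
    P (X @^-1` B) = (@lebesgue_measure R) (B `&` `[0%R, 1%R]).

Definition random_points {Omega : Type} {R : realType}
    (U : nat -> Omega -> R) (n : nat) (w : Omega) : 'I_n -> pt R :=
  fun i => (U (2 * i)%N w, U (2 * i + 1)%N w).
Arguments random_points {Omega R} U n w _.

(* Main.v *)
(** Write c(t) for the length of a tour t visiting m <= k points, d(x) for the distance
    from x to the depot, rad = (2/k) * sum d(x), and q = n^(1/4). Averaging the partitioned
    tours gives ITP(T) <= rad + cost(T), so it suffices that rad + TSP <= 1.915 * OPT.

    Both rad and TSP are at most OPT, and TSP <= sqrt(2n) + O(1) for any points of the unit
    square. The gain is OPT >= rad + (1/8 - o(1)) sqrt n: pairing the i-th point of a tour
    with the one m/2 steps later (cyclically) and applying the triangle inequality gives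
    m c(t) - 2 sum d(x) >= the total length of m windows of t, each with at least m/2
    points; and a first-moment bound shows that a.a.s. no collection of few disjoint paths
    visits N of the random points with total length much below N / (4 sqrt n). Tours with
    m < k contribute (k - m) c(t) besides, which is bounded below by the same count for
    paths rooted at the depot. As 1/8 > 0.085 * sqrt 2, this suffices when k is at least a
    large multiple of q; for smaller k already rad is much larger than TSP.

    The first moment only involves the cell of each point in an n x n grid, so it is a
    count of the maps from points to cells. *)
Require Import Defs.
From HB Require Import structures.
From mathcomp Require Import all_boot all_order all_algebra.
From mathcomp Require Import all_classical all_reals all_analysis.
From mathcomp Require Import fingroup perm.
From mathcomp Require Import zify ring lra.
(* Again, since mathcomp-analysis has an [edist] of its own. *)
Require Import Defs.
Set Implicit Arguments.
Unset Strict Implicit.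
Unset Printing Implicit Defensive.
Import Order.TTheory GRing.Theory Num.Theory.
Import numFieldNormedType.Exports.
Local Open Scope classical_set_scope.
Local Open Scope ring_scope.

(** * Paths, tour partitioning and the travelling salesman tour *)

Lemma le_of_sqr (R : realType) (x y : R) : 0 <= y -> x ^+ 2 <= y ^+ 2 -> x <= y.
Proof.
by move=> y0 h; rewrite leNgt; apply/negP => xy; nra.
Qed.

Definition l1dist {R : realType} (p q : pt R) : R :=
  `|p.1 - q.1| + `|p.2 - q.2|.

Lemma edist_ge0 (R : realType) (x y : pt R) : 0 <= edist x y.
Proof. exact: sqrtr_ge0. Qed.

Lemma edistxx (R : realType) (x : pt R) : edist x x = 0.
Proof. by rewrite /edist !subrr expr0n /= addr0 sqrtr0. Qed.

Lemma edistC (R : realType) (x y : pt R) : edist x y = edist y x.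
Proof. by rewrite /edist -[x.1 - _]opprB -[x.2 - _]opprB !sqrrN. Qed.

Lemma edist_sqr (R : realType) (x y : pt R) :
  edist x y ^+ 2 = (x.1 - y.1) ^+ 2 + (x.2 - y.2) ^+ 2.
Proof. by rewrite sqr_sqrtr // addr_ge0 ?sqr_ge0. Qed.

Lemma edist_triangle (R : realType) (y x z : pt R) :
  edist x z <= edist x y + edist y z.
Proof.
apply: le_of_sqr; first by rewrite addr_ge0 ?edist_ge0.
rewrite sqrrD !edist_sqr.
set a := x.1 - y.1; set b := x.2 - y.2; set c := y.1 - z.1; set d := y.2 - z.2.
have -> : x.1 - z.1 = a + c by rewrite /a /c; ring.
have -> : x.2 - z.2 = b + d by rewrite /b /d; ring.
suff : a * c + b * d <= edist x y * edist y z by lra.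
apply: le_of_sqr; first by rewrite mulr_ge0 ?edist_ge0.
rewrite exprMn !edist_sqr -/a -/b -/c -/d.
have := sqr_ge0 (a * d - b * c); nra.
Qed.

Lemma edist_le_l1 (R : realType) (x y : pt R) : edist x y <= l1dist x y.
Proof.
apply: le_of_sqr; first by rewrite addr_ge0.
rewrite edist_sqr /l1dist.
rewrite -(real_normK (num_real (x.1 - y.1))) -(real_normK (num_real (x.2 - y.2))).
have := mulr_ge0 (normr_ge0 (x.1 - y.1)) (normr_ge0 (x.2 - y.2)); nra.
Qed.

Lemma l1_le_edist (R : realType) (x y : pt R) :
  l1dist x y <= Num.sqrt 2 * edist x y.
Proof.
apply: le_of_sqr; first by rewrite mulr_ge0 ?sqrtr_ge0 ?edist_ge0.
rewrite exprMn sqr_sqrtr // edist_sqr /l1dist.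
rewrite -(real_normK (num_real (x.1 - y.1))) -(real_normK (num_real (x.2 - y.2))).
have := sqr_ge0 (`|x.1 - y.1| - `|x.2 - y.2|); nra.
Qed.

Lemma pathlen_ge0 (R : realType) (x : pt R) s : 0 <= pathlen x s.
Proof. by elim: s x => //= y s IH x; rewrite addr_ge0 ?edist_ge0. Qed.

Lemma pathlen_cat (R : realType) (x : pt R) s1 s2 :
  pathlen x (s1 ++ s2) = pathlen x s1 + pathlen (last x s1) s2.
Proof. by elim: s1 x => [|y s IH] x /=; rewrite ?add0r // IH addrA. Qed.

Lemma pathlen_rcons (R : realType) (x : pt R) s y :
  pathlen x (rcons s y) = pathlen x s + edist (last x s) y.
Proof. by rewrite -cats1 pathlen_cat /= addr0. Qed.

Lemma pathlen_start (R : realType) (x y : pt R) s :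
  pathlen x s <= edist x y + pathlen y s.
Proof.
case: s => [|z s] /=; first by rewrite addr0 edist_ge0.
by rewrite addrA lerD2r edist_triangle.
Qed.

(** Shortcutting, by the triangle inequality. The final point [e] stays in place, so that the lemma
    applies to closed tours. *)
Lemma pathlen_subseq (R : realType) (x : pt R) s1 s2 (e : pt R) :
  subseq s1 s2 -> pathlen x (rcons s1 e) <= pathlen x (rcons s2 e).
Proof.
elim: s2 s1 x => [|z s2 IH] [|y s1] x //=.
  move=> _; have /= h := pathlen_start x z [:: e]; apply: le_trans h _.
  by rewrite lerD2l; apply: (IH [::]); exact: sub0seq.
case: eqP => [->|_] h; first by rewrite lerD2l IH.
have /= h' := pathlen_start x z (y :: rcons s1 e); apply: le_trans h' _.
by rewrite lerD2l (IH (y :: s1)).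
Qed.

Lemma route_cost_ge0 (R : realType) (O : pt R) s : 0 <= route_cost O s.
Proof. exact: pathlen_ge0. Qed.

Lemma route_cost_subseq (R : realType) (O : pt R) s1 s2 :
  subseq s1 s2 -> route_cost O s1 <= route_cost O s2.
Proof. exact: pathlen_subseq. Qed.

Lemma pathlen_le_route_cost (R : realType) (O : pt R) s :
  pathlen O s <= route_cost O s.
Proof. by rewrite /route_cost pathlen_rcons lerDl edist_ge0. Qed.

Lemma route_cost_cat (R : realType) (O : pt R) s1 s2 :
  route_cost O (s1 ++ s2) <= route_cost O s1 + route_cost O s2.
Proof.
rewrite /route_cost rcons_cat pathlen_cat (pathlen_rcons O s1).
have := pathlen_start (last O s1) O (rcons s2 O); lra.
Qed.

Lemma route_cost_flatten (R : realType) (O : pt R) (S : seq (seq (pt R))) :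
  route_cost O (flatten S) <= routes_cost O S.
Proof.
rewrite /routes_cost; elim: S => [|s S IH]; rewrite ?big_nil ?big_cons /=.
  by rewrite /route_cost /= edistxx addr0.
by apply: le_trans (route_cost_cat _ _ _) _; rewrite lerD2l.
Qed.

(* Price of a return to the depot just before the point of index j > 0. *)
Definition cut_cost {R : realType} (O : pt R) (s : seq (pt R)) (j : nat) : R :=
  edist O (nth O s j.-1) + edist O (nth O s j).

Lemma cut_cost_ge0 (R : realType) (O : pt R) s j : 0 <= cut_cost O s j.
Proof. by rewrite addr_ge0 ?edist_ge0. Qed.

Lemma route_cost_split (R : realType) (O : pt R) i s : (0 < i < size s)%N ->
  route_cost O (take i s) + route_cost O (drop i s) <=
  route_cost O s + cut_cost O s i.
Proof.
move=> /andP[i0 iS].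
rewrite -{3}(cat_take_drop i s) /route_cost rcons_cat pathlen_cat pathlen_rcons.
rewrite (drop_nth O) //= /cut_cost.
have -> : last O (take i s) = nth O s i.-1.
  rewrite (last_nth O) size_take iS; case: i i0 iS => //= i _ iS.
  by rewrite nth_take.
have := edist_ge0 (nth O s i.-1) (nth O s i).
have := edistC O (nth O s i.-1); lra.
Qed.

(** Induction on the fuel: cutting off the first [k] points shifts the remaining indices by [k], so
    the later cuts stay at positive multiples of [k]. *)
Lemma routes_cost_chunks (R : realType) (O : pt R) k f s :
  (0 < k)%N -> (size s <= f)%N ->
  routes_cost O (chunks f k s) <= route_cost O s +
    \sum_(0 <= j < size s) (if (0 < j)%N && (k %| j)%N then cut_cost O s j else 0).
Proof.
move=> k0; set F := fun s j => if (0 < j)%N && (k %| j)%N then cut_cost O s j else 0.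
have F0 t j : 0 <= F t j by rewrite /F; case: ifP => // _; exact: cut_cost_ge0.
have FS t u v : 0 <= \sum_(u <= j < v) F t j by apply: sumr_ge0 => j _.
elim: f s => [|f IH] s sf /=.
  by rewrite /routes_cost big_nil addr_ge0 ?route_cost_ge0 //; apply: FS.
case: s sf => [|x s0] sf.
  by rewrite /routes_cost big_nil addr_ge0 ?route_cost_ge0 //; apply: FS.
set s := x :: s0 in sf *.
rewrite /routes_cost big_cons -/(routes_cost _ _).
have [ks|sk] := ltnP k (size s); last first.
  rewrite take_oversize // drop_oversize //.
  have -> : routes_cost O (chunks f k [::]) = 0.
    by rewrite /routes_cost; case: f {IH sf} => [|f]; rewrite big_nil.
  by rewrite lerD2l; apply: FS.
have sd : size (drop k s) = (size s - k)%N by rewrite size_drop.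
have /IH h1 : (size (drop k s) <= f)%N by rewrite sd; lia.
have := @route_cost_split _ O k s; rewrite k0 ks => /(_ isT) h2.
suff : \sum_(0 <= j < size (drop k s)) F (drop k s) j + cut_cost O s k <=
   \sum_(0 <= j < size s) F s j.
  rewrite -/(F _); move: h1; rewrite -/(F _); lra.
rewrite (@big_cat_nat _ _ _ k 0 (size s) _ _ (leq0n k) (ltnW ks)) /=.
apply: ler_wpDl; first exact: FS.
(* The term at 0 of the tail vanishes, there being no cut before its first point; its counterpart at
   [k] is the cut just made. *)
rewrite -{4}(add0n k) big_addn -sd big_ltn ?sd ?subn_gt0 // [leRHS]big_ltn ?subn_gt0 //.
have -> : F s (0 + k)%N = cut_cost O s k by rewrite /F add0n k0 dvdnn.
have -> : F (drop k s) 0%N = 0 by [].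
rewrite add0r [leLHS]addrC lerD2l.
rewrite !big_nat; apply: ler_sum => j /andP[j0 jk].
rewrite /F j0 addn_gt0 j0 /= dvdn_addl //; case: ifP => // _.
rewrite /cut_cost !nth_drop; have -> : (k + j.-1 = (j + k).-1)%N by lia.
by rewrite addnC.
Qed.

(** The first cut is before index [i] and the others follow at distance [k], so all are at indices
    congruent to [i]. *)
Lemma itp_solution_cost (R : realType) (O : pt R) k i s :
  (0 < k)%N -> (0 < i)%N -> (i <= k)%N ->
  routes_cost O (itp_solution k i s) <= route_cost O s +
    \sum_(1 <= j < size s) (if (j == i %[mod k])%N then cut_cost O s j else 0).
Proof.
move=> k0 i0 ik; rewrite /itp_solution /routes_cost big_cons -/(routes_cost _ _).
set F := fun j => if (j == i %[mod k])%N then cut_cost O s j else 0.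
have F0 j : 0 <= F j by rewrite /F; case: ifP => // _; exact: cut_cost_ge0.
have [iS|si] := ltnP i (size s); last first.
  rewrite take_oversize // drop_oversize //.
  have -> : routes_cost O (chunks (size s) k [::]) = 0.
    by rewrite /routes_cost; case: (size s) => [|f]; rewrite big_nil.
  by rewrite lerD2l; apply: sumr_ge0 => j _; apply: F0.
have sd : size (drop i s) = (size s - i)%N by rewrite size_drop.
have := @routes_cost_chunks _ O k (size s) (drop i s) k0.
rewrite sd leq_subr => /(_ isT); set G := (X in _ <= _ + X -> _) => h1.
have := @route_cost_split _ O i s; rewrite i0 iS => /(_ isT) h2.
suff : G + cut_cost O s i <= \sum_(1 <= j < size s) F j by move: h1 h2; lra.
rewrite (@big_cat_nat _ _ _ i 1 (size s) _ _ i0 (ltnW iS)) /=.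
apply: ler_wpDl; first by apply: sumr_ge0 => j _; apply: F0.
rewrite -{2}(add0n i) big_addn /G [X in X + _ <= _]big_ltn ?subn_gt0 //.
rewrite [X in _ <= X]big_ltn ?subn_gt0 //.
have -> : F (0 + i)%N = cut_cost O s i by rewrite /F add0n eqxx.
rewrite add0r [leLHS]addrC lerD2l.
rewrite !big_nat; apply: ler_sum => j /andP[j0 jk].
have -> : F (j + i)%N = if (k %| j)%N then cut_cost O s (j + i) else 0.
  by rewrite /F -{2}(add0n i) eqn_modDr mod0n.
rewrite j0 /=; case: ifP => // _.
rewrite /cut_cost !nth_drop; have -> : (i + j.-1 = (j + i).-1)%N by lia.
by rewrite addnC.
Qed.

(** Each index is a cut for exactly one offset [i]. Over all offsets, the edge from the depot to a
    point is thus bought at most twice, at the cuts just before and just after the point. *)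
Lemma sum_itp_solution_cost (R : realType) (O : pt R) k s : (0 < k)%N ->
  \sum_(1 <= i < k.+1) routes_cost O (itp_solution k i s) <=
  k%:R * route_cost O s + 2 * \sum_(x <- s) edist O x.
Proof.
move=> k0.
apply: (@le_trans _ _ (\sum_(1 <= i < k.+1) (route_cost O s +
    \sum_(1 <= j < size s) (if (j == i %[mod k])%N then cut_cost O s j else 0)))).
  rewrite !big_nat; apply: ler_sum => i /andP[i0 ik]; exact: itp_solution_cost.
rewrite big_split /= sumr_const_nat subn1 /= -(mulr_natl (route_cost O s)) lerD2l exchange_big /=.
apply: (@le_trans _ _ (\sum_(1 <= j < size s) cut_cost O s j)).
  rewrite !big_nat; apply: ler_sum => j /andP[j0 js].
  rewrite -big_mkcond /= (big_addn 0 _ 1) subn1 /=.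
  (* Offsets being renumbered from 0, the one that cuts before [j] is [j.-1] modulo [k]. *)
  rewrite big_mkord (eq_bigl (pred1 (Ordinal (ltn_pmod j.-1 k0)))) ?big_pred1_eq //.
  move=> i /=; rewrite -{1}(prednK j0) -addn1 eqn_modDr (modn_small (ltn_ord i)).
  by rewrite eq_sym.
rewrite /cut_cost big_split /=.
have e : \sum_(x <- s) edist O x = \sum_(0 <= j < size s) edist O (nth O s j).
  by rewrite (big_nth O).
case: s e => [|x s] e; first by rewrite !big_nil; lra.
set D := \sum_(y <- _) _ in e *.
suff : \sum_(1 <= j < size (x :: s)) edist O (nth O (x :: s) j.-1) <= D /\
  \sum_(1 <= j < size (x :: s)) edist O (nth O (x :: s) j) <= D by lra.
rewrite e; split; last by rewrite [leRHS]big_ltn // lerDr edist_ge0.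
rewrite /= (big_addn 0 _ 1) subn1 /= [leRHS]big_nat_recr //= ler_wpDr ?edist_ge0 //.
by apply: ler_sum => j _; rewrite addn1.
Qed.

Lemma ITP_le (R : realType) n (O : pt R) (V : 'I_n -> pt R) k T : (0 < k)%N ->
  ITP O V k T <= tsp_cost O V T + 2 / k%:R * \sum_(i < n) edist O (V i).
Proof.
move=> k0; have kR : 0 < k%:R :> R by rewrite ltr0n.
rewrite -(ler_pM2l kR) mulrDr.
have -> : k%:R * (2 / k%:R * \sum_(i < n) edist O (V i)) =
    2 * \sum_(x <- tour_seq V T) edist O x.
  rewrite /tour_seq big_map big_enum /= (reindex_inj (@perm_inj _ T)) /=.
  by field; rewrite gt_eqF.
apply: le_trans (sum_itp_solution_cost O _ k0).
rewrite mulr_natl -[X in _ *+ X](subn1 k.+1) -sumr_const_nat /ITP !big_nat.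
by apply: ler_sum => i ik; apply: bigmin_inf_seq (lexx _); rewrite ?mem_index_iota.
Qed.

(** * Upper bounds on the travelling salesman tour *)

Lemma tour_of_seq (R : realType) n (V : 'I_n -> pt R) (s : seq 'I_n) :
  perm_eq s (enum 'I_n) -> exists T, tour_seq V T = map V s.
Proof.
move=> es; have us : uniq s by rewrite (perm_uniq es) enum_uniq.
have sz : size s = n by rewrite (perm_size es) size_enum_ord.
have inj : injective (fun i : 'I_n => nth i s i).
  move=> i j; rewrite (set_nth_default j) ?sz // => /eqP.
  by rewrite nth_uniq ?sz // => /eqP/val_inj.
exists (perm inj); rewrite /tour_seq.
case: n V s es us sz inj => [|n] V s es us sz inj.
  have s0 : s = [::] by apply/nilP; rewrite /nilp sz.
  by rewrite [in RHS]s0 enum_ord0.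
have sE : size [seq V (perm inj i) | i <- enum 'I_n.+1] = n.+1.
  by rewrite size_map size_enum_ord.
apply: (@eq_from_nth _ (0, 0)); rewrite sE ?size_map ?sz // => i iN.
rewrite [LHS](nth_map ord0) ?size_enum_ord // [RHS](nth_map ord0) ?sz // permE.
rewrite (set_nth_default ord0) ?sz //; congr (V (nth _ _ _)).
by rewrite nth_enum_ord.
Qed.

Lemma tsp_opt_le_seq (R : realType) n (O : pt R) (V : 'I_n -> pt R) (s : seq 'I_n) :
  perm_eq s (enum 'I_n) -> tsp_opt O V <= route_cost O (map V s).
Proof.
move=> es; have [T eT] := tour_of_seq V es.
by rewrite /tsp_opt; apply: (@bigmin_inf _ _ _ _ T) => //; rewrite /tsp_cost eT.
Qed.

(* Serpentine order: [sg] is the abscissa along a 1-Lipschitz curve of length L,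
   [h] the detour from the curve. *)
Lemma tsp_opt_curve (R : realType) n (O : pt R) (V : 'I_n -> pt R)
    (sg h : 'I_n -> R) (L D : R) :
  0 <= L -> 0 <= D ->
  (forall i, 0 <= h i) -> (forall i, 0 <= sg i <= L) ->
  (forall i, edist O (V i) <= D) ->
  (forall i j, edist (V i) (V j) <= h i + h j + `|sg i - sg j|) ->
  tsp_opt O V <= 2 * \sum_i h i + L + 2 * D.
Proof.
move=> L0 D0 h0 sgL dO dV.
set r := fun i j => sg i <= sg j.
have rt : transitive r by move=> i j k; apply: le_trans.
have rtot : total r by move=> i j; apply: le_total.
set s := sort r (enum 'I_n).
have es : perm_eq s (enum 'I_n) by rewrite perm_sort.
have hs : \sum_i h i = \sum_(i <- s) h i.
  by rewrite -big_enum /= (perm_big _ es).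
apply: le_trans (tsp_opt_le_seq O V es) _; rewrite hs.
have : sorted r s by apply: sort_sorted.
case: (s) => [_|i t /= pt].
  by rewrite /route_cost /= edistxx big_nil; lra.
(* The [h j] on the left stands for the way from the curve to [j]; [L - sg j] is the part of the
   curve still ahead. *)
have main : forall j u, path r j u -> h j + pathlen (V j) (rcons (map V u) O) <=
    2 * \sum_(x <- j :: u) h x + (L - sg j) + D.
  move=> j u; elim: u j => [|v u IH] j /=.
    move=> _; rewrite big_seq1 edistC addr0; have := dO j; have := h0 j.
    by have /andP[_ ] := sgL j; lra.
  move=> /andP[jv /IH]; rewrite big_cons => IHv.
  have := dV j v; rewrite ler0_norm ?subr_le0 // => e1.
  lra.
have := main i t pt; rewrite /route_cost /=; have := dO i; have := h0 i.
by have /andP[] := sgL i; lra.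
Qed.

(** Abscissa of the point at height [y] on the [s]-th vertical line, for a curve that runs up the
    even and down the odd lines, each of length 1, with connections of length [w]. *)
Definition serpentine {R : realType} (w : R) (s : nat) (y : R) : R :=
  s%:R * (1 + w) + (if odd s then 1 - y else y).

Lemma serpentine_lipschitz (R : realType) (w : R) s s' y y' :
  0 <= w -> 0 <= y <= 1 -> 0 <= y' <= 1 ->
  `|s%:R * w - s'%:R * w| + `|y - y'| <= `|serpentine w s y - serpentine w s' y'|.
Proof.
move=> w0; wlog ss' : s s' y y' / (s <= s')%N => [hw|] y1 y1'.
  have [h|/ltnW h] := leqP s s'; first exact: hw.
  by rewrite distrC (distrC y) (distrC (serpentine _ _ _)); apply: hw.
rewrite distrC (distrC (serpentine _ _ _)) -mulrBl -natrB //.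
rewrite [`|_ * w|]ger0_norm ?mulr_ge0 ?ler0n //.
have [->|s's] := eqVneq s' s.
  rewrite subnn mul0r add0r /serpentine; case: ifP => _; last first.
    by rewrite (distrC y) opprD addrACA subrr add0r.
  by rewrite opprD addrACA subrr add0r (_ : 1 - y' - (1 - y) = y - y') //; ring.
apply: le_trans (ler_norm _); rewrite /serpentine.
have : (s'%:R : R) = s%:R + (s' - s)%:R by rewrite natrB //; ring.
have : s' = s.+1 \/ (2 <= s' - s)%N by lia.
have : `|y - y'| <= 1 by rewrite ler_norml; lra.
move: (y1) (y1') => /andP[? ?] /andP[? ?] yy.
case=> [->|h] ->.
  have -> : (s.+1 - s)%N = 1%N by lia.
  by rewrite /=; case: (odd s) => /=; case: (lerP y y') => ?; rewrite mulrDl; lra.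
have {}h : 2 <= (s' - s)%:R :> R by rewrite ler_nat.
have : 0 <= (if odd s' then 1 - y' else y') by case: ifP => _; lra.
have : (if odd s then 1 - y else y) <= 1 by case: ifP => _; lra.
move: h; move: (if odd s' then _ else _) (if odd s then _ else _) ((s' - s)%:R : R).
by move=> A B e h B1 A0; lra.
Qed.

Lemma tsp_opt_serpentine (R : realType) n (O : pt R) (V : 'I_n -> pt R)
    (w c : R) (st : 'I_n -> nat) (M : nat) (D : R) :
  0 <= w -> 0 <= D -> (forall i, 0 <= (V i).2 <= 1) -> (forall i, (st i <= M)%N) ->
  (forall i, edist O (V i) <= D) ->
  tsp_opt O V <= 2 * \sum_i `|(V i).1 - (c + (st i)%:R * w)| +
    M.+1%:R * (1 + w) + 2 * D.
Proof.
move=> w0 D0 V2 stM dD.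
apply: (@tsp_opt_curve _ _ _ _ (fun i => serpentine w (st i) (V i).2)) => //.
- by rewrite mulr_ge0 ?addr_ge0.
- move=> i; rewrite /serpentine; have /andP[a b] := V2 i.
  have : 0 <= (if odd (st i) then 1 - (V i).2 else (V i).2) <= 1.
    by case: ifP => _; lra.
  have : (st i)%:R <= M%:R :> R by rewrite ler_nat.
  have : 0 <= (st i)%:R :> R by rewrite ler0n.
  rewrite -natr1 => p q /andP[u v]; apply/andP; split; nra.
move=> i j; apply: le_trans (edist_le_l1 _ _) _; rewrite /l1dist.
have := serpentine_lipschitz (st i) (st j) w0 (V2 i) (V2 j).
set a := (V i).1; set b := (V j).1; set ci := _ * w; set cj := _ * w.
have : `|a - b| <= `|a - (c + ci)| + `|b - (c + cj)| + `|ci - cj|.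
  have -> : a - b = (a - (c + ci)) - (b - (c + cj)) + (ci - cj) by ring.
  apply: le_trans (ler_normD _ _) _; rewrite lerD2r; exact: ler_normB.
by lra.
Qed.

(* Two strip patterns shifted by half a width: the detours of a point sum to half
   a width, so one of the two tours is short. *)
Lemma tsp_opt_unit_square (R : realType) n (O : pt R) (V : 'I_n -> pt R) :
  (forall i, 0 <= (V i).1 <= 1) -> (forall i, 0 <= (V i).2 <= 1) ->
  tsp_opt O V <= 99 / 70 * Num.sqrt n%:R + (10 + 2 * `|O.1| + 2 * `|O.2|).
Proof.
move=> V1 V2; set D : R := `|O.1| + `|O.2| + 2.
have D0 : 0 <= D by rewrite !addr_ge0.
have dD i : edist O (V i) <= D.
  apply: le_trans (edist_le_l1 _ _) _; rewrite /l1dist /D.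
  have := ler_normB O.1 (V i).1; have := ler_normB O.2 (V i).2.
  have /andP[a b] := V1 i; have /andP[a' b'] := V2 i.
  by rewrite (ger0_norm a) (ger0_norm a'); lra.
(* About [a] strips balance the vertical runs, one per strip, against the detours, which cost
   [n * w / 2] on average over the two tours. 99/70 is just above the square root of 2. *)
pose a : R := Num.sqrt (n%:R / 2).
have a0 : 0 <= a by rewrite sqrtr_ge0.
have aa : a ^+ 2 = n%:R / 2 by rewrite sqr_sqrtr // divr_ge0.
have aQ : 2 * a <= 99 / 70 * Num.sqrt n%:R.
  have n0 := ler0n R n.
  apply: le_of_sqr; first by rewrite mulr_ge0 ?sqrtr_ge0 ?divr_ge0.
  by rewrite !exprMn aa sqr_sqrtr //; move: n0; clear; lra.
pose S := (Num.truncn a).+1; pose w : R := S%:R^-1.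
have S0 : 0 < S%:R :> R by rewrite ltr0n.
have w0 : 0 <= w by rewrite invr_ge0 ltW.
have wS : w * S%:R = 1 by rewrite mulVf ?gt_eqF.
have w1 : w <= 1 by rewrite invf_le1 // ler1n.
have /andP[Sa aS] := truncn_itv a0.
have {}Sa : S%:R <= a + 1 by rewrite -natr1 lerD2r.
pose f i := Num.truncn ((V i).1 * S%:R).
have u0 i : 0 <= (V i).1 * S%:R by rewrite mulr_ge0 ?ler0n //; case/andP: (V1 i).
have fi i := truncn_itv (u0 i).
have fS i : (f i <= S)%N.
  rewrite -(ler_nat R); have /andP[h _] := fi i; apply: le_trans h _.
  by rewrite ler_piMl ?(ltW S0) //; case/andP: (V1 i).
(* The nearer of the two boundaries of the strip numbered [f i]; that number is [S] when the
   abscissa is 1. *)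
pose g i := if (V i).1 * S%:R - (f i)%:R <= 2^-1 then f i else (f i).+1.
have gS i : (g i <= S.+1)%N by rewrite /g; case: ifP => _; have := fS i; lia.
have hA := @tsp_opt_serpentine _ _ O V w (w / 2) f S.+1 D w0 D0 V2
   (fun i => leqW (fS i)) dD.
have hB := @tsp_opt_serpentine _ _ O V w 0 g S.+1 D w0 D0 V2 gS dD.
have hAB : \sum_i `|(V i).1 - (w / 2 + (f i)%:R * w)| +
           \sum_i `|(V i).1 - (0 + (g i)%:R * w)| <= n%:R * w / 2.
  rewrite -big_split /=; apply: (@le_trans _ _ (\sum_(i < n) w / 2)).
    apply: ler_sum => i _; set x := (V i).1.
    have ex : x = (x * S%:R) * w by rewrite -mulrA (mulrC _ w) wS mulr1.
    have /andP[p q] := fi i; rewrite -/(f i) -natr1 in q p *; rewrite -/x in p q.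
    rewrite ex /g -/x; set u := x * S%:R in p q *; set m := (f i)%:R in p q *.
    have -> : u * w - (w / 2 + m * w) = (u - m - 2^-1) * w by field.
    rewrite add0r; case: (lerP (u - m) 2^-1) => um; last rewrite -(natr1 (f i));
      rewrite -/m -mulrBl !normrM (ger0_norm w0).
      rewrite (ler0_norm (x := u - m - _)); last by lra.
      by rewrite (ger0_norm (x := u - m)); nra.
    rewrite (ger0_norm (x := u - m - _)); last by lra.
    by rewrite (ler0_norm (x := u - _)); nra.
  by rewrite sumr_const card_ord -(mulr_natl (w / 2)) mulrA.
have nw : n%:R * w <= 2 * a.
  have -> : n%:R = 2 * a * a :> R by rewrite -mulrA -expr2 aa; field.
  have aw : a * w <= 1 by rewrite -wS mulrC ler_wpM2l // ltW.
  by rewrite -mulrA ler_piMr // mulr_ge0.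
have eL : (S.+2)%:R * (1 + w) = S%:R + 3 + 2 * w :> R.
  rewrite -(addn2 S) natrD; move: wS; clear; move: (S%:R : R) => s; nra.
move: hA hB hAB nw aQ Sa w1 w0; rewrite eL /D; clear.
move: (\sum_i _) (\sum_i _) (tsp_opt _ _) (Num.sqrt _) (n%:R * w) (S%:R) => A B T Q N s.
lra.
Qed.

(** * Windows of a tour *)

(** Each point is kept only in the first tour of the list that visits it; shortcutting past the
    other points does not raise the cost. *)
Lemma disjoint_tours (R : realType) n (O : pt R) (V : 'I_n -> pt R) k
    (tours : seq (seq 'I_n)) :
  (forall t, t \in tours -> size (undup t) <= k)%N ->
  (forall i, exists2 t, t \in tours & i \in t) ->
  exists S : seq (seq 'I_n),
    [/\ perm_eq (flatten S) (enum 'I_n), (forall t, t \in S -> size t <= k)%N &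
        \sum_(t <- S) route_cost O (map V t) <=
        \sum_(t <- tours) route_cost O (map V t)].
Proof.
move=> szk cov.
(* The vacuous condition is there to be generalized: [[::]] becomes the list of the points visited
   by earlier tours. *)
suff [S [uS mS sS cS]] : exists S : seq (seq 'I_n),
    [/\ uniq (flatten S),
        (forall x, x \in flatten S = (x \notin [::]) && (x \in flatten tours)),
        (forall t, t \in S -> size t <= k)%N &
        \sum_(t <- S) route_cost O (map V t) <=
        \sum_(t <- tours) route_cost O (map V t)].
  exists S; split=> //; apply: uniq_perm; rewrite ?enum_uniq // => x.
  rewrite mS mem_enum /=; have [t tt xt] := cov x.
  by apply/flattenP; exists t.
move: [::] => seen; elim: tours szk seen {cov} => [|t ts IH] szk seen.
  by exists [::]; split=> // x; rewrite /= !in_nil andbF.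
have szk' u : u \in ts -> (size (undup u) <= k)%N.
  by move=> h; apply: szk; rewrite inE h orbT.
have [S [uS mS sS cS]] := IH szk' (t ++ seen).
set t' := undup [seq x <- t | x \notin seen].
have mt' x : x \in t' = (x \notin seen) && (x \in t).
  by rewrite mem_undup mem_filter.
exists (t' :: S); split=> /=.
- rewrite cat_uniq undup_uniq uS andbT /=; apply/hasPn => x.
  by rewrite mS mem_cat negb_or mt' => /andP[/andP[/negbTE-> _] _]; rewrite andbF.
- move=> x; rewrite !mem_cat mt' mS mem_cat negb_or.
  by case: (x \in t); case: (x \in seen).
- move=> u; rewrite inE => /orP[/eqP->|/sS//].
  apply: leq_trans (szk t (mem_head _ _)); apply: uniq_leq_size (undup_uniq _) _ => x.
  by rewrite mt' mem_undup => /andP[].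
- rewrite !big_cons; apply: lerD => //; apply/route_cost_subseq/map_subseq.
  exact: subseq_trans (undup_subseq _) (filter_subseq _ _).
Qed.

Definition path_length {R : realType} (s : seq (pt R)) : R :=
  if s is x :: s' then pathlen x s' else 0.

Lemma path_length_ge0 (R : realType) (s : seq (pt R)) : 0 <= path_length s.
Proof. by case: s => //= x s; apply: pathlen_ge0. Qed.

Definition segment {T : Type} (a b : nat) (s : seq T) : seq T :=
  take (b - a).+1 (drop a s).

Lemma subseq_segment (T : eqType) a b (s : seq T) : subseq (segment a b s) s.
Proof. exact: subseq_trans (take_subseq _ _) (drop_subseq _ _). Qed.

Lemma size_segment (T : Type) a b (s : seq T) :
  (a <= b < size s)%N -> size (segment a b s) = (b - a).+1.
Proof. by move=> /andP[ab bs]; rewrite size_takel // size_drop; lia. Qed.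

Lemma segment_cost (R : realType) (O : pt R) a b s : (a <= b < size s)%N ->
  edist O (nth O s a) + path_length (segment a b s) + edist O (nth O s b) <=
  route_cost O s.
Proof.
move=> /andP[ab bs]; apply: le_trans (route_cost_subseq O (subseq_segment a b s)).
have e : segment a b s = nth O s a :: take (b - a) (drop a.+1 s).
  by rewrite /segment (drop_nth O) //; exact: leq_ltn_trans ab bs.
have l : last (nth O s a) (take (b - a) (drop a.+1 s)) = nth O s b.
  have := nth_last O (segment a b s); rewrite size_segment ?ab // {2}e /= => <-.
  by rewrite /segment nth_take ?ltnS // nth_drop /= subnKC.
by rewrite e /route_cost /= pathlen_rcons l (edistC O (nth O s b)) addrA.
Qed.

(* The stretch of the tour between the points of ranks i and i + m/2 (mod m). *)
Definition window {T : Type} (s : seq T) (i : nat) : seq T :=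
  let j := ((i + (size s)./2) %% size s)%N in segment (minn i j) (maxn i j) s.

Lemma subseq_window (T : eqType) (s : seq T) i : subseq (window s i) s.
Proof. exact: subseq_segment. Qed.

Lemma window_map (T T' : Type) (f : T -> T') s i :
  window (map f s) i = map f (window s i).
Proof. by rewrite /window /segment size_map -map_drop -map_take. Qed.

(** With [m] points in [s], a window that does not wrap around has [m./2 + 1] of them; otherwise it
    is the stretch on the other side, with [m - m./2 + 1]. *)
Lemma size_window (T : Type) (s : seq T) i :
  (i < size s)%N -> (size s < (size (window s i)).*2)%N.
Proof.
move=> is_; have s0 : (0 < size s)%N by lia.
rewrite /window; set j := (_ %% _)%N; have js : (j < size s)%N by rewrite ltn_mod.
rewrite size_segment; last by rewrite gtn_max is_ js andbT leq_max geq_minl.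
have [h|h] := ltnP (i + (size s)./2) (size s); rewrite /j.
  by rewrite modn_small //; have := odd_double_half (size s); lia.
have -> : (i + (size s)./2 = i + (size s)./2 - size s + size s)%N by lia.
rewrite modnDr modn_small; have := odd_double_half (size s); lia.
Qed.

(* Sum the triangle inequality at the two ends of each window; every point is an end
   of exactly two windows. *)
Lemma sum_window_le (R : realType) (O : pt R) s :
  \sum_(0 <= i < size s) path_length (window s i) + 2 * \sum_(x <- s) edist O x <=
  (size s)%:R * route_cost O s.
Proof.
set m := size s.
have [m0|m0] := posnP m.
  by rewrite /m (size0nil m0) !big_nil mulr0 mul0r addr0.
pose j (i : 'I_m) := Ordinal (ltn_pmod (i + m./2) m0).
have jinj : injective j.
  move=> i i' [] /eqP; rewrite eqn_modDr !modn_small // => /eqP; exact: val_inj.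
have e1 : \sum_(x <- s) edist O x = \sum_(i < m) edist O (nth O s i).
  by rewrite (big_nth O) big_mkord.
have e2 : \sum_(x <- s) edist O x = \sum_(i < m) edist O (nth O s (j i)).
  by rewrite e1 (reindex_inj jinj).
rewrite mulrDl mul1r {1}e1 e2 big_mkord -!big_split /=.
have -> : m%:R * route_cost O s = \sum_(i < m) route_cost O s.
  by rewrite sumr_const card_ord mulr_natl.
apply: ler_sum => i _; set k := ((i + m./2) %% m)%N.
have km : (k < m)%N by rewrite ltn_pmod.
have /(segment_cost O) : (minn i k <= maxn i k < size s)%N.
  by rewrite gtn_max ltn_ord km andbT leq_max geq_minl.
rewrite -/(window s i); case: (leqP i k) => ik; rewrite /window -/m -/k.
  by rewrite (minn_idPl ik) (maxn_idPr ik); lra.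
by rewrite (minn_idPr (ltnW ik)) (maxn_idPl (ltnW ik)); lra.
Qed.

(** * Chains of random cells: counting *)

(** [c] is the cell that the first step leaves. A product with one factor per step can be summed
    over all [f] one point at a time. *)
Fixpoint chain_weight {R : realType} {I C : Type} (W : C -> C -> R) (f : I -> C)
    (c : C) (s : seq I) : R :=
  if s is i :: s' then W c (f i) * chain_weight W f (f i) s' else 1.

Lemma chain_weight_ge0 (R : realType) (I C : Type) (W : C -> C -> R) (f : I -> C) c s :
  (forall c c', 0 <= W c c') -> 0 <= chain_weight W f c s.
Proof. by move=> W0; elim: s c => //= i s IH c; rewrite mulr_ge0. Qed.

Definition ffun_upd {I C : finType} (f : {ffun I -> C}) (i : I) (c : C) : {ffun I -> C} :=
  [ffun j => if j == i then c else f j].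

Lemma chain_weight_upd (R : realType) (I C : finType) (W : C -> C -> R)
    (f : {ffun I -> C}) i c' c s :
  i \notin s -> chain_weight W (ffun_upd f i c') c s = chain_weight W f c s.
Proof.
elim: s c => //= j s IH c; rewrite inE negb_or => /andP[ij /IH IHs].
by rewrite ffunE eq_sym (negbTE ij) IHs.
Qed.

(** Counting form of the fact that the cell of [i] is uniform and independent of the other cells:
    exchanging [f i] with a separate cell is an involution on pairs. *)
Lemma sum_ffun_upd (R : realType) (I C : finType) (G : C -> {ffun I -> C} -> R) i :
  (forall c c' f, G c (ffun_upd f i c') = G c f) ->
  #|C|%:R * (\sum_(f : {ffun I -> C}) G (f i) f) = \sum_c \sum_(f : {ffun I -> C}) G c f.
Proof.
move=> Gu; rewrite pair_big /=.
pose h (p : C * {ffun I -> C}) := (p.2 i, ffun_upd p.2 i p.1).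
have hK : involutive h.
  move=> [c f]; rewrite /h /= ffunE eqxx; congr (_, _).
  by apply/ffunP => j; rewrite !ffunE; case: eqP => [->|].
rewrite (reindex_inj (inv_inj hK)) /=.
rewrite (eq_bigr (fun p : C * {ffun I -> C} => G (p.2 i) p.2)); last first.
  by move=> p _; rewrite Gu.
rewrite -(pair_big xpredT xpredT (fun (c : C) (f : {ffun I -> C}) => G (f i) f)) /=.
by rewrite sumr_const mulr_natl.
Qed.

(** The first point of the chain does not recur in the rest, so its cell can be summed separately,
    which yields a row sum of [W]. *)
Lemma sum_chain_weight (R : realType) (I C : finType) (W : C -> C -> R) (om : R) c s :
  (forall c c', 0 <= W c c') -> 0 <= om ->
  (forall c, \sum_c' W c c' <= om * #|C|%:R) -> uniq s ->
  \sum_(f : {ffun I -> C}) chain_weight W f c s <= om ^+ size s * #|{ffun I -> C}|%:R.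
Proof.
move=> W0 om0 hW; elim: s c => [|i s IH] c /=.
  by rewrite sumr_const mul1r.
move=> /andP[is_ us].
have C0 : 0 < #|C|%:R :> R by rewrite ltr0n; apply/card_gt0P; exists c.
rewrite -(ler_pM2l C0).
rewrite (@sum_ffun_upd _ _ _ (fun c' f => W c c' * chain_weight W f c' s) i); last first.
  by move=> c1 c2 f; rewrite chain_weight_upd.
apply: (@le_trans _ _ (\sum_c' W c c' * (om ^+ size s * #|{ffun I -> C}|%:R))).
  by apply: ler_sum => c' _; rewrite -mulr_sumr ler_wpM2l // IH.
rewrite -mulr_suml exprS !mulrA ler_wpM2r // mulrAC (mulrC #|C|%:R).
rewrite -mulrA [leLHS]mulrC.
apply: ler_wpM2l; first exact: exprn_ge0.
by rewrite mulrC.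
Qed.

Lemma card_markov (R : realType) (F : finType) (g : F -> R) (K : R) :
  0 < K -> (forall f, 0 <= g f) ->
  #|[set f | K < g f]%SET|%:R * K <= \sum_f g f.
Proof.
move=> K0 g0; rewrite mulr_natl -sumr_const.
rewrite [leRHS](bigID (mem [set f | K < g f]%SET)) /=.
apply: ler_wpDr; first by apply: sumr_ge0.
by apply: ler_sum => f; rewrite inE => /ltW.
Qed.

(* First moment: there are at most n ^ m duplicate-free sequences of length m. *)
Lemma card_heavy_chain (R : realType) n (C : finType) (W : C -> C -> R) (om z K : R) c :
  (0 < n)%N -> (forall c c', 0 <= W c c') -> 0 <= om -> 0 <= z -> 0 < K ->
  (forall c, \sum_c' W c c' <= om * #|C|%:R) -> n%:R * (z * om) <= 1 ->
  #|[set f : {ffun 'I_n -> C} |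
      ~~ `[< forall s, uniq s -> z ^+ size s * chain_weight W f c s <= K >]]%SET|%:R * K
   <= (n.+1)%:R * #|{ffun 'I_n -> C}|%:R.
Proof.
move=> n0 W0 om0 z0 K0 hW hz.
pose g (f : {ffun 'I_n -> C}) :=
  \sum_(m < n.+1) \sum_(t : m.-tuple 'I_n | uniq t) z ^+ m * chain_weight W f c t.
have gt f m (t : m.-tuple 'I_n) : 0 <= z ^+ m * chain_weight W f c t.
  by rewrite mulr_ge0 ?exprn_ge0 ?chain_weight_ge0.
have g0 f : 0 <= g f by apply: sumr_ge0 => m _; apply: sumr_ge0.
apply: (@le_trans _ _ (\sum_f g f)); last first.
  rewrite /g exchange_big /=.
  apply: (@le_trans _ _ (\sum_(m < n.+1) #|{ffun 'I_n -> C}|%:R)); last first.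
    by rewrite sumr_const card_ord mulr_natl.
  apply: ler_sum => m _; rewrite exchange_big /=.
  apply: (@le_trans _ _ (\sum_(t : m.-tuple 'I_n | uniq t)
      (z * om) ^+ m * #|{ffun 'I_n -> C}|%:R)).
    apply: ler_sum => t ut; rewrite -mulr_sumr exprMn -mulrA ler_wpM2l ?exprn_ge0 //.
    by have := sum_chain_weight c W0 om0 hW ut; rewrite size_tuple.
  rewrite sumr_const -mulrnAl ler_piMl // -mulr_natl.
  apply: (@le_trans _ _ (n%:R ^+ m * (z * om) ^+ m)).
    rewrite ler_wpM2r ?exprn_ge0 ?mulr_ge0 // -natrX ler_nat.
    by rewrite -[X in (_ <= X ^ _)%N]card_ord -card_tuple max_card.
  by rewrite -exprMn exprn_ile1 // mulr_ge0 // mulr_ge0.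
apply: le_trans (card_markov K0 g0).
rewrite ler_wpM2r ?(ltW K0) // ler_nat; apply: subset_leq_card.
apply/fintype.subsetP => f; rewrite !inE; apply: contraR; rewrite -leNgt => gK.
apply/asboolP => s us; apply: le_trans gK.
have sn : (size s < n.+1)%N.
  by rewrite ltnS -[X in (_ <= X)%N]card_ord -(card_uniqP us) max_card.
rewrite /g (bigD1 (Ordinal sn)) //= (bigD1 (in_tuple s)) //= -addrA lerDl.
by rewrite addr_ge0 ?sumr_ge0 // => i _; apply: sumr_ge0.
Qed.

(** For a single prescribed sequence there is no union bound, so no factor [n] enters the condition
    on [z * om]. *)
Lemma card_heavy_chain1 (R : realType) (I C : finType) (W : C -> C -> R) (om z K : R) c s :
  (forall c c', 0 <= W c c') -> 0 <= om -> 0 <= z -> 0 < K ->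
  (forall c, \sum_c' W c c' <= om * #|C|%:R) -> z * om <= 1 -> uniq s ->
  #|[set f : {ffun I -> C} | K < z ^+ size s * chain_weight W f c s]%SET|%:R * K
   <= #|{ffun I -> C}|%:R.
Proof.
move=> W0 om0 z0 K0 hW hz us.
apply: le_trans (card_markov K0 _) _.
  by move=> f; rewrite mulr_ge0 ?exprn_ge0 ?chain_weight_ge0.
rewrite -mulr_sumr.
apply: (@le_trans _ _ (z ^+ size s * (om ^+ size s * #|{ffun I -> C}|%:R))).
  by rewrite ler_wpM2l ?exprn_ge0 // sum_chain_weight.
by rewrite mulrA -exprMn ler_piMl // exprn_ile1 // mulr_ge0.
Qed.

(** * Chains of random cells: lengths *)

(** Two geometric series, to the right and to the left of [p], each of sum at most [1 / (1 - r)],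
    hence at most [1 + 1 / x]. *)
Lemma sum_expR_line (R : realType) (x p : R) n : 0 < x ->
  \sum_(j < n) expR (- (x * `|j%:R - p|)) <= 2 + 2 / x.
Proof.
move=> x0; set r := expR (- x).
have r0 : 0 < r by apply: expR_gt0.
have rx : r * (1 + x) <= 1.
  have h : 1 + x <= expR x := expR_ge1Dx x.
  have := ler_wpM2l (ltW r0) h.
  by rewrite /r -expRD addNr expR0.
(* Truncated exponentials whose increments telescope to the two series; the [+ 1] makes [psi j.+1]
   the term at [j < p]. *)
pose phi (j : nat) := expR (- (x * Num.max (j%:R - p) 0)).
pose psi (j : nat) := expR (- (x * Num.max (p - j%:R + 1) 0)).
have phi1 j : 0 <= phi j <= 1.
  by rewrite /phi expR_ge0 /= expR_le1 oppr_le0 mulr_ge0 ?(ltW x0) // le_max lexx orbT.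
have psi1 j : 0 <= psi j <= 1.
  by rewrite /psi expR_ge0 /= expR_le1 oppr_le0 mulr_ge0 ?(ltW x0) // le_max lexx orbT.
have phiS j : phi j.+1 <= phi j.
  rewrite /phi ler_expR lerN2 ler_wpM2l ?(ltW x0) // -natr1.
  by rewrite !maxEle; case: ifP => ?; case: ifP => ?; lra.
have psiS j : psi j <= psi j.+1.
  rewrite /psi ler_expR lerN2 ler_wpM2l ?(ltW x0) // -natr1.
  by rewrite !maxEle; case: ifP => ?; case: ifP => ?; lra.
have term j : (1 - r) * expR (- (x * `|j%:R - p|)) <=
    (phi j - phi j.+1) + (psi j.+1 - psi j).
  have [jp|jp] := lerP p j%:R.
    apply: (@le_trans _ _ (phi j - phi j.+1)); last by rewrite lerDl subr_ge0.
    rewrite /phi -natr1 !max_l ?ger0_norm; try lra.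
    rewrite mulrBl mul1r lerD2l lerN2 /r -expRD ler_expR; lra.
  apply: (@le_trans _ _ (psi j.+1 - psi j)); last by rewrite lerDr subr_ge0.
  rewrite /psi -natr1 !max_l ?ltr0_norm; try lra.
  rewrite mulrBl mul1r; apply: lerB; first by rewrite ler_expR; lra.
  by rewrite /r -expRD ler_expR; lra.
have tele (m : nat) :
    (1 - r) * (\sum_(j < m) expR (- (x * `|j%:R - p|))) <= (1 - phi m) + psi m.
  elim: m => [|m IH].
    by rewrite big_ord0 mulr0; have := phi1 0%N; have := psi1 0%N; lra.
  by rewrite big_ord_recr /= mulrDr; have := term m; lra.
have r1 : 0 < 1 - r by nra.
rewrite -(ler_pM2l r1); apply: le_trans (tele n) _.
apply: (@le_trans _ _ 2); first by have := phi1 n; have := psi1 n; lra.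
have -> : 2 + 2 / x = 2 * ((1 + x) / x) by field; rewrite gt_eqF.
rewrite mulrCA -{1}[2]mulr1 ler_wpM2l // mulrA ler_pdivlMr // mul1r; nra.
Qed.

Definition cell_corner {R : realType} n (c : 'I_n * 'I_n) : pt R :=
  (c.1%:R / n%:R, c.2%:R / n%:R).

(** In the l1 metric the exponential factors over the two coordinates, which is why cells are
    compared in that metric. *)
Lemma sum_expR_grid (R : realType) n (mu : R) (p : pt R) : (0 < n)%N -> 0 < mu ->
  \sum_(c : 'I_n * 'I_n) expR (- (mu * l1dist p (cell_corner c))) <=
  (2 / mu + 2 / n%:R) ^+ 2 * #|{: 'I_n * 'I_n}|%:R.
Proof.
move=> n0 mu0; have nR : 0 < n%:R :> R by rewrite ltr0n.
have line (a : R) : \sum_(j < n) expR (- (mu * `|a - j%:R / n%:R|)) <=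
    (2 / mu + 2 / n%:R) * n%:R.
  have := @sum_expR_line _ (mu / n%:R) (a * n%:R) n (divr_gt0 mu0 nR).
  have -> : 2 + 2 / (mu / n%:R) = (2 / mu + 2 / n%:R) * n%:R.
    by field; rewrite !gt_eqF.
  apply: le_trans; apply: ler_sum => j _; rewrite ler_expR lerN2 -mulrA.
  rewrite ler_wpM2l ?(ltW mu0) // -{1}(ger0_norm (x := n%:R^-1)) ?invr_ge0 ?(ltW nR) //.
  rewrite -normrM distrC; have -> // : n%:R^-1 * (j%:R - a * n%:R) = j%:R / n%:R - a.
  by field; rewrite gt_eqF.
rewrite card_prod card_ord natrM -expr2 -exprMn expr2.
apply: (@le_trans _ _ ((\sum_(j < n) expR (- (mu * `|p.1 - j%:R / n%:R|))) *
   (\sum_(j < n) expR (- (mu * `|p.2 - j%:R / n%:R|))))).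
  rewrite big_distrlr /= pair_big /=; apply: ler_sum => c _.
  by rewrite -expRD /l1dist /= mulrDr opprD.
by apply: ler_pM => //; apply: sumr_ge0 => j _; apply: expR_ge0.
Qed.

Fixpoint step_sum {R : realType} {I : Type} (len : I -> I -> R) (i : I) (s : seq I) : R :=
  if s is j :: s' then len i j + step_sum len j s' else 0.

Definition start_sum {R : realType} {I : Type} (st : I -> R) (len : I -> I -> R)
    (s : seq I) : R :=
  if s is i :: s' then st i + step_sum len i s' else 0.

(** A family of paths is read as one chain. Entering the next path costs [st], from whatever cell
    the previous one ended in. *)
Lemma chain_weight_flatten (R : realType) (I C : Type) (W : C -> C -> R) (f : I -> C)
    (st : I -> R) (len : I -> I -> R) ws c :
  (forall c i, expR (- st i) <= W c (f i)) ->
  (forall i j, expR (- len i j) <= W (f i) (f j)) ->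
  expR (- \sum_(w <- ws) start_sum st len w) <= chain_weight W f c (flatten ws).
Proof.
move=> hst hlen; elim: ws c => [|w ws IH] c.
  by rewrite big_nil oppr0 expR0.
rewrite big_cons opprD expRD; case: w => [|i w] /=.
  by rewrite oppr0 expR0 mul1r.
rewrite opprD expRD -mulrA; apply: ler_pM; rewrite ?mulr_ge0 ?expR_ge0 //.
elim: w i => [|j w IHw] i /=; first by rewrite oppr0 expR0 mul1r.
by rewrite opprD expRD -mulrA; apply: ler_pM; rewrite ?mulr_ge0 ?expR_ge0.
Qed.

Definition in_cell {R : realType} n (p : pt R) (c : 'I_n * 'I_n) : Prop :=
  (cell_corner c).1 <= p.1 < (cell_corner c).1 + n%:R^-1 /\
  (cell_corner c).2 <= p.2 < (cell_corner c).2 + n%:R^-1.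

(** In each coordinate both points lie less than [1 / n] beyond their corners, so the mesh adds at
    most [1 / n]. *)
Lemma l1_corner_le (R : realType) n (p p' : pt R) (c c' : 'I_n * 'I_n) :
  in_cell p c -> in_cell p' c' ->
  l1dist (cell_corner c) (cell_corner c') <= Num.sqrt 2 * edist p p' + 2 / n%:R.
Proof.
move=> [/andP[a1 a2] /andP[a3 a4]] [/andP[b1 b2] /andP[b3 b4]].
have := l1_le_edist p p'; rewrite /l1dist.
set x := cell_corner c in a1 a2 a3 a4 *; set y := cell_corner c' in b1 b2 b3 b4 *.
have h1 : `|x.1 - y.1| <= `|p.1 - p'.1| + n%:R^-1.
  have -> : x.1 - y.1 = (p.1 - p'.1) + ((p'.1 - y.1) - (p.1 - x.1)) by ring.
  by apply: le_trans (ler_normD _ _) _; rewrite lerD2l ler_norml; lra.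
have h2 : `|x.2 - y.2| <= `|p.2 - p'.2| + n%:R^-1.
  have -> : x.2 - y.2 = (p.2 - p'.2) + ((p'.2 - y.2) - (p.2 - x.2)) by ring.
  by apply: le_trans (ler_normD _ _) _; rewrite lerD2l ler_norml; lra.
lra.
Qed.

Lemma l1_corner_le1 (R : realType) n (O p : pt R) (c : 'I_n * 'I_n) :
  in_cell p c ->
  l1dist O (cell_corner c) <= Num.sqrt 2 * edist O p + 2 / n%:R.
Proof.
move=> [/andP[a1 a2] /andP[a3 a4]].
have := l1_le_edist O p; rewrite /l1dist; set x := cell_corner c in a1 a2 a3 a4 *.
have h1 : `|O.1 - x.1| <= `|O.1 - p.1| + n%:R^-1.
  have -> : O.1 - x.1 = (O.1 - p.1) + (p.1 - x.1) by ring.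
  by apply: le_trans (ler_normD _ _) _; rewrite lerD2l ler_norml; lra.
have h2 : `|O.2 - x.2| <= `|O.2 - p.2| + n%:R^-1.
  have -> : O.2 - x.2 = (O.2 - p.2) + (p.2 - x.2) by ring.
  by apply: le_trans (ler_normD _ _) _; rewrite lerD2l ler_norml; lra.
lra.
Qed.

Lemma step_sum_pathlen (R : realType) (I : Type) (V : I -> pt R) (lam e : R) i s :
  step_sum (fun i j => lam * edist (V i) (V j) + e) i s =
  lam * pathlen (V i) (map V s) + e * (size s)%:R.
Proof.
elim: s i => [|j s IH] i /=; first by rewrite !mulr0 addr0.
by rewrite IH -natr1; ring.
Qed.

Lemma start_sum_free (R : realType) (I : Type) (V : I -> pt R) (b lam e : R) s :
  0 <= b -> 0 <= e ->
  start_sum (fun=> b) (fun i j => lam * edist (V i) (V j) + e) s <=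
  b + lam * path_length (map V s) + e * (size s)%:R.
Proof.
move=> b0 e0; case: s => [|i s] /=; first by rewrite !mulr0 !addr0.
by rewrite step_sum_pathlen -natr1; lra.
Qed.

Lemma start_sum_rooted (R : realType) (I : Type) (O : pt R) (V : I -> pt R) (lam e : R) s :
  start_sum (fun i => lam * edist O (V i) + e) (fun i j => lam * edist (V i) (V j) + e) s =
  lam * pathlen O (map V s) + e * (size s)%:R.
Proof.
case: s => [|i s] /=; first by rewrite !mulr0 addr0.
by rewrite step_sum_pathlen -natr1; ring.
Qed.

(* A step either has to be paid for by its length or is a jump, at the price [b]. *)
Definition free_weight {R : realType} n (b mu : R) (c c' : 'I_n * 'I_n) : R :=
  expR (- b) + expR (- (mu * l1dist (cell_corner c) (cell_corner c'))).

(** The weight of a star: every step starts at the depot, so the exponents along a chain add up to a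
    sum of distances from the depot. *)
Definition root_weight {R : realType} n (O : pt R) (mu : R) (c c' : 'I_n * 'I_n) : R :=
  expR (- (mu * l1dist O (cell_corner c'))).

(* Here a jump leads back to the depot, and is paid for by its length. *)
Definition rooted_weight {R : realType} n (O : pt R) (mu : R) (c c' : 'I_n * 'I_n) : R :=
  root_weight O mu c c' + expR (- (mu * l1dist (cell_corner c) (cell_corner c'))).

Lemma natr_size_flatten (R : realType) (T : Type) (ws : seq (seq T)) :
  (size (flatten ws))%:R = \sum_(w <- ws) (size w)%:R :> R.
Proof.
elim: ws => [|w ws IH]; first by rewrite big_nil.
by rewrite big_cons /= size_cat natrD IH.
Qed.

Lemma expR_chain_le (R : realType) (y s : R) m w :
  expR s <= w -> expR 2 ^+ m * w <= expR y -> 2 * m%:R - y <= - s.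
Proof.
move=> sw h; suff : expR (2 * m%:R + s) <= expR y by rewrite ler_expR; lra.
rewrite expRD expRM_natr; apply: le_trans h.
by rewrite ler_wpM2l ?exprn_ge0 ?expR_ge0.
Qed.

Lemma sqrt2_bounds (R : realType) : 4 / 3 <= (Num.sqrt 2 : R) <= 99 / 70.
Proof.
apply/andP; split; apply: le_of_sqr; rewrite ?sqrtr_ge0 // ?sqr_sqrtr //; lra.
Qed.

(* [lam / sqrt 2] is the rate in the l1 metric matching the rate [lam] in the Euclidean one. *)
Lemma l1_rate (R : realType) n (lam : R) : 0 <= lam -> (0 < n)%N ->
  let mu := lam / Num.sqrt 2 in
  [/\ 0 <= mu, forall d l, l <= Num.sqrt 2 * d + 2 / n%:R -> mu * l <= lam * d + 2 * mu / n%:R &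
   forall m, (m <= n)%N -> 2 * mu / n%:R * m%:R <= 3 / 2 * lam].
Proof.
move=> lam0 n0 mu; have /andP[r1 r2] := sqrt2_bounds R.
have r0 : 0 < Num.sqrt 2 :> R by lra.
have mu0 : 0 <= mu by rewrite divr_ge0 // ltW.
have nR : 0 < n%:R :> R by rewrite ltr0n.
have er : mu * Num.sqrt 2 = lam by rewrite divfK // gt_eqF.
split=> // [d l h|m mn].
  have := ler_wpM2l mu0 h; rewrite mulrDr mulrA er.
  by rewrite (_ : mu * (2 / n%:R) = 2 * mu / n%:R) //; ring.
have h : m%:R <= n%:R :> R by rewrite ler_nat.
rewrite mulrAC ler_pdivrMr //; apply: (@le_trans _ _ (2 * mu * n%:R)).
  by rewrite ler_wpM2l // mulr_ge0.
rewrite ler_wpM2r ?(ltW nR) // -er; nra.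
Qed.

Lemma uniq_size_ord n (s : seq 'I_n) : uniq s -> (size s <= n)%N.
Proof. by move=> us; rewrite -[leqRHS]card_ord -(card_uniqP us) max_card. Qed.

(** Taking logarithms, twice the number of points minus [8 * q] is at most the charge of the chain:
    length at rate [8 * Q], [8 * q] per path for the jump to it, and at most [12 * Q] for the
    mesh. *)
Lemma free_paths_ge (R : realType) n (V : 'I_n -> pt R) (f : 'I_n -> 'I_n * 'I_n) c
    (q Q : R) (ws : seq (seq 'I_n)) :
  (0 < n)%N -> 0 <= q -> 0 <= Q -> (forall i, in_cell (V i) (f i)) ->
  uniq (flatten ws) ->
  expR 2 ^+ size (flatten ws) *
    chain_weight (free_weight (8 * q) (8 * Q / Num.sqrt 2)) f c (flatten ws)
    <= expR (8 * q) ->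
  (size (flatten ws))%:R <= 4 * Q * \sum_(w <- ws) path_length (map V w) +
    4 * q * ((size ws)%:R + 1) + 6 * Q.
Proof.
move=> n0 q0 Q0 cV us.
have Q8 : 0 <= 8 * Q by rewrite mulr_ge0.
have [mu0 hmu hsz] := l1_rate Q8 n0; move: mu0 hmu hsz.
set mu := 8 * Q / _ => mu0 hmu hsz; set e := 2 * mu / n%:R.
have e0 : 0 <= e by rewrite divr_ge0 ?mulr_ge0.
have q8 : 0 <= 8 * q by rewrite mulr_ge0.
have := @chain_weight_flatten _ _ _ (free_weight (8 * q) mu) f (fun=> 8 * q)
  (fun i j => 8 * Q * edist (V i) (V j) + e) ws c.
move=> h /expR_chain_le; move=> /(_ _ (h _ _)); rewrite opprK => {}h.
apply: le_trans (_ : _ <= 2^-1 * (8 * q + \sum_(w <- ws)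
  (8 * q + 8 * Q * path_length (map V w) + e * (size w)%:R))) _; last first.
  rewrite 2!big_split /= -!mulr_sumr -natr_size_flatten.
  rewrite big_const_seq count_predT iter_addr_0 -mulr_natr.
  by have := hsz _ (uniq_size_ord us); rewrite -/e; lra.
have : \sum_(w <- ws) start_sum (fun=> 8 * q) (fun i j => 8 * Q * edist (V i) (V j) + e) w <=
  \sum_(w <- ws) (8 * q + 8 * Q * path_length (map V w) + e * (size w)%:R).
  by apply: ler_sum => w _; apply: start_sum_free.
suff : 2 * (size (flatten ws))%:R - 8 * q <= \sum_(w <- ws)
   start_sum (fun=> 8 * q) (fun i j => 8 * Q * edist (V i) (V j) + e) w by lra.
apply: h => [c' i|i j]; first by rewrite lerDl expR_ge0.
apply: ler_wpDl; first exact: expR_ge0.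
by rewrite ler_expR lerN2; apply/hmu/l1_corner_le.
Qed.

(** As for free paths, but the way from the depot is part of the length, so nothing is charged per
    path. The rate [16 * Q] is halved to [8 * Q], the coefficient to which windows, with half the
    points of their tours, also lead. *)
Lemma rooted_paths_ge (R : realType) n (O : pt R) (V : 'I_n -> pt R)
    (f : 'I_n -> 'I_n * 'I_n) c (q Q : R) (ws : seq (seq 'I_n)) :
  (0 < n)%N -> 0 <= Q -> (forall i, in_cell (V i) (f i)) ->
  uniq (flatten ws) ->
  expR 2 ^+ size (flatten ws) *
    chain_weight (rooted_weight O (16 * Q / Num.sqrt 2)) f c (flatten ws)
    <= expR (8 * q) ->
  (size (flatten ws))%:R <= 8 * Q * \sum_(w <- ws) pathlen O (map V w) +
    4 * q + 12 * Q.
Proof.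
move=> n0 Q0 cV us.
have Q16 : 0 <= 16 * Q by rewrite mulr_ge0.
have [mu0 hmu hsz] := l1_rate Q16 n0; move: mu0 hmu hsz.
set mu := 16 * Q / _ => mu0 hmu hsz; set e := 2 * mu / n%:R.
have := @chain_weight_flatten _ _ _ (rooted_weight O mu) f
  (fun i => 16 * Q * edist O (V i) + e)
  (fun i j => 16 * Q * edist (V i) (V j) + e) ws c.
move=> h /expR_chain_le; move=> /(_ _ (h _ _)); rewrite opprK.
under eq_bigr do rewrite start_sum_rooted.
rewrite big_split /= -!mulr_sumr -natr_size_flatten => {}h.
have := hsz _ (uniq_size_ord us); rewrite -/e.
suff : 2 * (size (flatten ws))%:R - 8 * q <=
  16 * Q * (\sum_(w <- ws) pathlen O (map V w)) + e * (size (flatten ws))%:R by lra.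
apply: h => [c' i|i j].
  apply: ler_wpDr; first exact: expR_ge0.
  by rewrite ler_expR lerN2; apply/hmu/l1_corner_le1.
apply: ler_wpDl; first exact: expR_ge0.
by rewrite ler_expR lerN2; apply/hmu/l1_corner_le.
Qed.

(** Every point is a path of its own from the depot. The chain is a fixed one, so a rate that does
    not grow with [n] suffices. *)
Lemma sum_root_ge (R : realType) n (O : pt R) (V : 'I_n -> pt R)
    (f : 'I_n -> 'I_n * 'I_n) c (q : R) :
  (0 < n)%N -> (forall i, in_cell (V i) (f i)) ->
  expR 2 ^+ size (enum 'I_n) *
    chain_weight (root_weight O (8 / Num.sqrt 2)) f c (enum 'I_n) <= expR (8 * q) ->
  n%:R <= 4 * (\sum_i edist O (V i)) + 4 * q + 6.
Proof.
move=> n0 cV; have [mu0 hmu hsz] := @l1_rate R n 8 (ler0n _ 8) n0; move: mu0 hmu hsz.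
set mu := 8 / _ => mu0 hmu hsz; set e := 2 * mu / n%:R.
have fl (s : seq 'I_n) : flatten (map (fun i => [:: i]) s) = s.
  by elim: s => //= i s ->.
have := @chain_weight_flatten _ _ _ (root_weight O mu) f
  (fun i => 8 * edist O (V i) + e)
  (fun i j => 8 * edist O (V j) + e) (map (fun i => [:: i]) (enum 'I_n)) c.
rewrite fl => h /expR_chain_le; move=> /(_ _ (h _ _)); rewrite opprK big_map big_enum /=.
under eq_bigr do rewrite addr0.
rewrite big_split /= -mulr_sumr sumr_const card_ord size_enum_ord.
rewrite -(mulr_natr e) (eq_bigl xpredT) // => {}h.
have := hsz _ (leqnn n); rewrite -/e.
suff : 2 * n%:R - 8 * q <= 8 * (\sum_i edist O (V i)) + e * n%:R by lra.
by apply: h => *; rewrite ler_expR lerN2; apply/hmu/l1_corner_le1.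
Qed.

(** * A typical sample is spread out *)

(** [1 - x <= expR (- x)] at [x = 1/32], then six squarings, rounding up. *)
Lemma expR2_le (R : realType) : expR 2 <= 77 / 10 :> R.
Proof.
set x : R := 32^-1.
have h1 : 1 - x <= expR (- x) by apply: expR_ge1Dx.
have h2 : expR x * expR (- x) = 1 by rewrite -expRD subrr expR0.
have E0 : 0 <= expR x by apply: expR_ge0.
have E1 : expR x <= 32 / 31 by rewrite /x in h1 h2 E0 *; nra.
have sq (y a b : R) : expR y <= a -> a ^+ 2 <= b -> expR (2 * y) <= b.
  move=> ya ab; rewrite mulr2n mulrDl mul1r expRD -expr2; apply: le_trans ab.
  by rewrite ler_pXn2r // ?nnegrE ?(le_trans _ ya) ?expR_ge0.
have e : 2 * (2 * (2 * (2 * (2 * (2 * x))))) = 2 by rewrite /x; lra.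
rewrite -[X in expR X]e.
apply: (sq _ (277 / 100)); last lra.
apply: (sq _ (16642 / 10000)); last lra.
apply: (sq _ (129 / 100)); last lra.
apply: (sq _ (11356 / 10000)); last lra.
apply: (sq _ (10656 / 10000)); last lra.
by apply: (sq _ (32 / 31)); last lra.
Qed.

Lemma inv_pow_ge_expRN (R : realType) (q : R) m : 0 < q -> expR (- (m%:R * q)) <= (q ^+ m)^-1.
Proof.
move=> q0; rewrite expRN expRM_natl lef_pV2 ?posrE ?exprn_gt0 ?expR_gt0 //.
rewrite lerXn2r ?nnegrE ?expR_ge0 ?(ltW q0) //.
by apply: le_trans (expR_ge1Dx q); rewrite lerDr.
Qed.

Lemma grid_rate (R : realType) n (q lam : R) :
  100 <= q -> q ^+ 4 = n%:R -> 0 < lam ->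
  0 <= 2 / (lam / Num.sqrt 2) + 2 / n%:R <= 99 / 35 / lam + 1000^-1 / q ^+ 2.
Proof.
move=> q100 qn lam0; have /andP[r1 r2] := sqrt2_bounds R.
have r0 : 0 < Num.sqrt 2 :> R by lra.
have q0 : 0 < q by lra.
have -> : 2 / (lam / Num.sqrt 2) = 2 * Num.sqrt 2 * lam^-1 by field; rewrite !gt_eqF.
have li : 0 < lam^-1 by rewrite invr_gt0.
have n0 : 0 < n%:R :> R by rewrite -qn exprn_gt0.
have qi : 0 < q^-1 <= 100^-1.
  by rewrite invr_gt0 q0 /= lef_pV2 ?posrE.
have e : 2 / n%:R <= 1000^-1 / q ^+ 2.
  rewrite -qn (_ : q ^+ 4 = q ^+ 2 * q ^+ 2); last by ring.
  rewrite invfM mulrA ler_wpM2r ?invr_ge0 ?exprn_ge0 ?(ltW q0) // -exprVn.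
  case/andP: qi; nra.
apply/andP; split.
  apply: addr_ge0; first by rewrite mulr_ge0 ?(ltW li) // mulr_ge0 // ltW.
  by rewrite divr_ge0 // ltW.
by apply: lerD => //; rewrite ler_wpM2r ?(ltW li) //; lra.
Qed.

Lemma sum_root_weight (R : realType) n (O : pt R) (mu : R) (c : 'I_n * 'I_n) :
  (0 < n)%N -> 0 < mu ->
  \sum_c' root_weight O mu c c' <= (2 / mu + 2 / n%:R) ^+ 2 * #|{: 'I_n * 'I_n}|%:R.
Proof. by move=> n0 mu0; apply: sum_expR_grid. Qed.

Lemma sum_rooted_weight (R : realType) n (O : pt R) (mu : R) (c : 'I_n * 'I_n) :
  (0 < n)%N -> 0 < mu ->
  \sum_c' rooted_weight O mu c c' <=
  (2 * (2 / mu + 2 / n%:R) ^+ 2) * #|{: 'I_n * 'I_n}|%:R.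
Proof.
move=> n0 mu0; rewrite big_split /= -mulrA mulrDl mul1r.
by apply: lerD; apply: sum_expR_grid.
Qed.

Lemma sum_free_weight (R : realType) n (b mu : R) (c : 'I_n * 'I_n) :
  (0 < n)%N -> 0 < mu ->
  \sum_c' free_weight b mu c c' <=
  (expR (- b) + (2 / mu + 2 / n%:R) ^+ 2) * #|{: 'I_n * 'I_n}|%:R.
Proof.
move=> n0 mu0; rewrite big_split /= mulrDl sumr_const -(mulr_natr (expR (- b))).
by apply: lerD => //; apply: sum_expR_grid.
Qed.

(* Here q = n ^ (1/4); the last terms, negligible against n, come from the jumps, the
   union bound and the mesh of the grid. *)
Record spread_out {R : realType} n (q : R) (O : pt R) (V : 'I_n -> pt R) : Prop :=
  SpreadOut {
    spread_free : forall ws : seq (seq 'I_n), uniq (flatten ws) ->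
      (size (flatten ws))%:R <= 4 * q ^+ 2 * \sum_(w <- ws) path_length (map V w) +
        4 * q * ((size ws)%:R + 1) + 6 * q ^+ 2;
    spread_rooted : forall ws : seq (seq 'I_n), uniq (flatten ws) ->
      (size (flatten ws))%:R <= 8 * q ^+ 2 * \sum_(w <- ws) pathlen O (map V w) +
        4 * q + 12 * q ^+ 2;
    spread_depot : n%:R <= 4 * (\sum_i edist O (V i)) + 4 * q + 6 }.

(** Among all cell maps, a share of at most [(n + 1) / K] violates each of the first two estimates,
    and [1 / K] the third. As [K >= n ^ 2], the total is at most [1 / q]. *)
Lemma most_cells_spread_out (R : realType) n (q : R) (O : pt R) :
  100 <= q -> q ^+ 4 = n%:R ->
  exists A : {set {ffun 'I_n -> 'I_n * 'I_n}},
    #|~: A|%:R * q <= #|{ffun 'I_n -> 'I_n * 'I_n}|%:R /\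
    forall f, f \in A -> forall V : 'I_n -> pt R, (forall i, in_cell (V i) (f i)) ->
      spread_out q O V.
Proof.
move=> q100 qn; have q0 : 0 < q by lra.
have nR : 0 < n%:R :> R by rewrite -qn exprn_gt0.
have n0 : (0 < n)%N by rewrite -(ltr0n R).
pose c : 'I_n * 'I_n := (Ordinal n0, Ordinal n0).
have q2 : 0 < q ^+ 2 by rewrite exprn_gt0.
have r0 : 0 < Num.sqrt 2 :> R by rewrite sqrtr_gt0.
pose z : R := expR 2; have z0 : 0 <= z by apply: expR_ge0.
have z77 : z <= 77 / 10 := expR2_le R.
pose K := expR (8 * q); have K0 : 0 < K by apply: expR_gt0.
(* From [q <= expR q] and [q ^ 8 = n ^ 2]. *)
have Kn : expR (- (8 * q)) <= (n%:R ^+ 2)^-1.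
  by rewrite -qn -exprM; apply: (inv_pow_ge_expRN 8 q0).
pose mu1 := 8 * q ^+ 2 / Num.sqrt 2; pose mu2 := 16 * q ^+ 2 / Num.sqrt 2.
pose mu3 : R := 8 / Num.sqrt 2.
have mu1_0 : 0 < mu1 by rewrite divr_gt0 // mulr_gt0.
have mu2_0 : 0 < mu2 by rewrite divr_gt0 // mulr_gt0.
have mu3_0 : 0 < mu3 by rewrite divr_gt0.
have q2i : 0 < (q ^+ 2)^-1 <= 100^-1.
  by rewrite invr_gt0 q2 /= lef_pV2 ?posrE //; move: q100; clear; nra.
have nq : n%:R = q ^+ 2 * q ^+ 2 by rewrite -qn; ring.
have nV : n%:R * (q ^+ 2)^-1 ^+ 2 = 1 by rewrite nq; field; rewrite gt_eqF.
have sqn (X a : R) : 0 <= X <= a * (q ^+ 2)^-1 -> n%:R * X ^+ 2 <= a ^+ 2.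
  move=> /andP[X0 Xa].
  have -> : a ^+ 2 = n%:R * (a * (q ^+ 2)^-1) ^+ 2 by rewrite exprMn mulrCA nV mulr1.
  rewrite ler_wpM2l ?(ltW nR) // ler_pXn2r // nnegrE //; exact: le_trans Xa.
have X1 : n%:R * (2 / mu1 + 2 / n%:R) ^+ 2 <= (11 / 31) ^+ 2.
  apply: sqn; have := grid_rate q100 qn (mulr_gt0 (ltr0n R 8) q2).
  case/andP=> -> /= h; apply: le_trans h _; rewrite invfM; lra.
have X2 : n%:R * (2 / mu2 + 2 / n%:R) ^+ 2 <= (9 / 50) ^+ 2.
  apply: sqn; have := grid_rate q100 qn (mulr_gt0 (ltr0n R 16) q2).
  case/andP=> -> /= h; apply: le_trans h _; rewrite invfM; lra.
have X3 : (2 / mu3 + 2 / n%:R) ^+ 2 <= (11 / 31) ^+ 2.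
  have := grid_rate q100 qn (ltr0n R 8).
  case/andP=> h0 h; rewrite ler_pXn2r // ?nnegrE //.
  apply: le_trans h _; case/andP: q2i; lra.
have nK : n%:R * expR (- (8 * q)) <= 1000^-1.
  apply: (@le_trans _ _ (n%:R * (n%:R ^+ 2)^-1)); first by rewrite ler_wpM2l ?(ltW nR).
  rewrite expr2 invfM mulrA divff ?gt_eqF // mul1r -qn (_ : q ^+ 4 = q ^+ 2 * q ^+ 2); last by ring.
  rewrite invfM; case/andP: q2i; nra.
pose om1 := expR (- (8 * q)) + (2 / mu1 + 2 / n%:R) ^+ 2.
pose om2 := 2 * (2 / mu2 + 2 / n%:R) ^+ 2.
pose om3 := (2 / mu3 + 2 / n%:R) ^+ 2.
have om1_0 : 0 <= om1 by rewrite addr_ge0 ?expR_ge0 ?sqr_ge0.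
have om2_0 : 0 <= om2 by rewrite mulr_ge0 ?sqr_ge0.
have om3_0 : 0 <= om3 by rewrite sqr_ge0.
(* This dictates the rate 8: up to small terms [n * om1] is [(2 * sqrt 2 / 8) ^ 2 = 1/8], and
   [expR 2 / 8 < 1]. Numerically, 7.7 times 0.129 is below 1. *)
have zt (m t : R) : 0 <= m * t -> m * t <= 129 / 1000 -> m * (z * t) <= 1.
  rewrite (mulrCA m z t); move: z0 z77; clear; move: (m * t) => u; nra.
have c1 : n%:R * (z * om1) <= 1.
  by apply: zt; [rewrite mulr_ge0 ?(ltW nR)|rewrite mulrDr; lra].
have c2 : n%:R * (z * om2) <= 1.
  by apply: zt; [rewrite mulr_ge0 ?(ltW nR)|rewrite mulrCA; lra].
have c3 : z * om3 <= 1.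
  by move: X3 om3_0; rewrite -/om3; move: z0 z77; clear; move: om3 => t; nra.
have free0 (x y : 'I_n * 'I_n) : 0 <= free_weight (8 * q) mu1 x y.
  by rewrite addr_ge0 ?expR_ge0.
have root0 (x y : 'I_n * 'I_n) : 0 <= root_weight O mu3 x y by apply: expR_ge0.
have rooted0 (x y : 'I_n * 'I_n) : 0 <= rooted_weight O mu2 x y.
  by rewrite addr_ge0 ?expR_ge0.
have h1 := card_heavy_chain c n0 free0 om1_0 z0 K0
  (fun x => sum_free_weight (8 * q) x n0 mu1_0) c1.
have h2 := card_heavy_chain c n0 rooted0 om2_0 z0 K0
  (fun x => sum_rooted_weight O x n0 mu2_0) c2.
have h3 := card_heavy_chain1 c root0 om3_0 z0 K0
  (fun x => sum_root_weight O x n0 mu3_0) c3 (enum_uniq 'I_n).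
set B1 := [set f | _]%SET in h1; set B2 := [set f | _]%SET in h2.
set B3 := [set f | _]%SET in h3; pose F : R := #|{ffun 'I_n -> 'I_n * 'I_n}|%:R.
have {}h1 : #|B1|%:R * K <= n.+1%:R * F := h1.
have {}h2 : #|B2|%:R * K <= n.+1%:R * F := h2.
have {}h3 : #|B3|%:R * K <= F := h3.
exists (~: (B1 :|: B2 :|: B3))%SET; split.
  rewrite finset.setCK -/F.
  have hc : (#|B1 :|: B2 :|: B3|%SET <= #|B1| + #|B2| + #|B3|)%N.
    apply: leq_trans (leq_card_setU _ _) _; rewrite leq_add2r.
    exact: leq_card_setU.
  have {}hc : #|B1 :|: B2 :|: B3|%SET%:R <= #|B1|%:R + #|B2|%:R + #|B3|%:R :> R.
    by rewrite -!natrD ler_nat.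
  have F0 : 0 <= F by apply: ler0n.
  have qK : (2 * n%:R + 3) * q <= K.
    have : n%:R ^+ 2 <= K.
      by move: Kn; rewrite -/K expRN lef_pV2 ?posrE ?exprn_gt0.
    apply: le_trans; rewrite -qn.
    have s100 : 100 * q <= q ^+ 2 by rewrite expr2 ler_wpM2r // ltW.
    have : 3 * q <= q ^+ 4.
      rewrite (_ : q ^+ 4 = q ^+ 2 * q ^+ 2); last by ring.
      by move: q100 s100; clear; move: (q ^+ 2) => s; nra.
    have : 100 <= q ^+ 4.
      rewrite (_ : q ^+ 4 = q ^+ 2 * q ^+ 2); last by ring.
      by move: q100 s100; clear; move: (q ^+ 2) => s; nra.
    move: q0; clear; move: (q ^+ 4) => t; nra.
  rewrite -natr1 in h1 h2; have p : 0 < 2 * n%:R + 3 :> R by move: nR; clear; lra.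
  rewrite -(ler_pM2l p) mulrCA; apply: le_trans (ler_wpM2l (ler0n _ _) qK) _.
  apply: le_trans (ler_wpM2r (ltW K0) hc) _; rewrite !mulrDl.
  by move: h1 h2 h3; clear; rewrite !mulrDl; lra.
move=> f; rewrite !inE !negb_or !negbK -leNgt => /andP[/andP[/asboolP f1 /asboolP f2] f3] V Vf.
split.
- move=> ws us; apply: (@free_paths_ge _ _ _ f c) => //; [exact: ltW|exact: ltW|].
  exact: f1.
- move=> ws us; apply: (@rooted_paths_ge _ _ _ _ f c) => //; [exact: ltW|].
  exact: f2.
- by apply: (@sum_root_ge _ _ _ _ f c).
Qed.

(** * The probability of a configuration of cells *)

Lemma in_cell_coord (R : realType) n (x : R) (a b : 'I_n) : (0 < n)%N ->
  a%:R / n%:R <= x < a%:R / n%:R + n%:R^-1 -> b%:R / n%:R <= x < b%:R / n%:R + n%:R^-1 ->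
  (a <= b)%N.
Proof.
move=> n0 /andP[a1 _] /andP[_ b2]; have nR : 0 < n%:R^-1 :> R by rewrite invr_gt0 ltr0n.
have : a%:R / n%:R < (b%:R + 1) / n%:R :> R by rewrite mulrDl mul1r (le_lt_trans a1).
by rewrite ltr_pM2r // natr1 ltr_nat ltnS.
Qed.

Lemma in_cell_inj (R : realType) n (p : pt R) (c c' : 'I_n * 'I_n) :
  (0 < n)%N -> in_cell p c -> in_cell p c' -> c = c'.
Proof.
case: c c' => [c1 c2] [d1 d2] n0 [/= a1 a2] [/= b1 b2].
congr (_, _); apply/val_inj/eqP; rewrite eqn_leq /=.
  by rewrite (in_cell_coord n0 a1 b1) (in_cell_coord n0 b1 a1).
by rewrite (in_cell_coord n0 a2 b2) (in_cell_coord n0 b2 a2).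
Qed.

(** Uniform coordinates lie in the unit interval only almost surely; on a cell event they always
    do. *)
Lemma in_cell_unit (R : realType) n (p : pt R) (c : 'I_n * 'I_n) :
  (0 < n)%N -> in_cell p c -> 0 <= p.1 <= 1 /\ 0 <= p.2 <= 1.
Proof.
move=> n0; have nR : 0 < n%:R^-1 :> R by rewrite invr_gt0 ltr0n.
have h (x : R) (a : 'I_n) : a%:R / n%:R <= x < a%:R / n%:R + n%:R^-1 -> 0 <= x <= 1.
  move=> /andP[a1 a2]; apply/andP; split.
    by apply: le_trans a1; rewrite divr_ge0.
  apply/ltW/(lt_le_trans a2); rewrite -{2}(mul1r n%:R^-1) -mulrDl natr1.
  by rewrite ler_pdivrMr ?ltr0n // mul1r ler_nat.
by case=> /h ? /h ?.
Qed.

Lemma prode_const (R : realType) (T : Type) (s : seq T) (x : R) :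
  (\prod_(j <- s) x%:E)%E = (x ^+ size s)%:E.
Proof.
elim: s => [|j s IH]; first by rewrite big_nil expr0.
by rewrite big_cons IH -EFinM -exprS.
Qed.

Definition cell_event {Omega : Type} {R : realType} (U : nat -> Omega -> R) n
    (f : 'I_n -> 'I_n * 'I_n) : set Omega :=
  [set w | forall i, in_cell (random_points U n w i) (f i)].

(* The coordinate [j] of the sample is the x- (j even) or y-coordinate (j odd) of the
   point [j./2]. *)
Definition cell_coord n (f : 'I_n -> 'I_n * 'I_n) (j : nat) : nat :=
  if insub j./2 is Some i then nat_of_ord (if odd j then (f i).2 else (f i).1) else 0%N.

Definition cell_slot {R : realType} n (f : 'I_n -> 'I_n * 'I_n) (j : nat) : set R :=
  [set` `[(cell_coord f j)%:R / n%:R, (cell_coord f j)%:R / n%:R + n%:R^-1[].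

Lemma cell_coord_lt n (f : 'I_n -> 'I_n * 'I_n) j : (0 < n)%N -> (cell_coord f j < n)%N.
Proof. by move=> n0; rewrite /cell_coord; case: insubP => // i _ _; case: ifP. Qed.

(** The event as a condition on each of the [2 * n] coordinates, the form to which independence
    applies. *)
Lemma cell_eventE (Omega : Type) (R : realType) (U : nat -> Omega -> R) n
    (f : 'I_n -> 'I_n * 'I_n) :
  cell_event U f = \bigcap_(j in [set` iota 0 (2 * n)]) (U j @^-1` cell_slot f j).
Proof.
have coord_even (i : 'I_n) : cell_coord f (2 * i) = (f i).1.
  by rewrite /cell_coord mul2n doubleK odd_double valK.
have coord_odd (i : 'I_n) : cell_coord f (2 * i + 1) = (f i).2.
  rewrite /cell_coord mul2n addn1 /= odd_double /= uphalf_double valK //.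
apply/seteqP; split=> w /= h.
  move=> j /=; rewrite mem_iota /= add0n => jn.
  have j2 : (j./2 < n)%N by have := odd_double_half j; lia.
  have [i ei] : exists i : 'I_n, nat_of_ord i = j./2 by exists (Ordinal j2).
  have [h1 h2] := h i; have := odd_double_half j; case oj: (odd j) => ej.
    have -> : j = (2 * i + 1)%N by lia.
    by rewrite /cell_slot /= coord_odd in_itv /=; exact: h2.
  have -> : j = (2 * i)%N by lia.
  by rewrite /cell_slot /= coord_even in_itv /=; exact: h1.
move=> i; split.
  have := h (2 * i)%N; rewrite /cell_slot /= coord_even in_itv /=; apply.
  by rewrite mem_iota; have := ltn_ord i; lia.
have := h (2 * i + 1)%N; rewrite /cell_slot /= coord_odd in_itv /=; apply.
by rewrite mem_iota; have := ltn_ord i; lia.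
Qed.

Lemma cell_slot_measurable (R : realType) n (f : 'I_n -> 'I_n * 'I_n) j :
  measurable (cell_slot f j : set R).
Proof. exact: measurable_itv. Qed.

Lemma prob_cell_slot (d : measure_display) (Omega : measurableType d)
    (R : realType) (P : probability Omega R) (U : nat -> Omega -> R) n (f : 'I_n -> 'I_n * 'I_n) j :
  uniform01 P (U j) -> (0 < n)%N ->
  P (U j @^-1` cell_slot f j) = (n%:R^-1 : R)%:E.
Proof.
move=> unifU n0; have nR : 0 < n%:R :> R by rewrite ltr0n.
have nV : 0 < n%:R^-1 :> R by rewrite invr_gt0.
have [_ ->] := unifU; last exact: cell_slot_measurable.
rewrite setIidl; last first.
  move=> x; rewrite /cell_slot /= !in_itv /= => /andP[a1 a2]; apply/andP; split.
    by apply: le_trans a1; rewrite divr_ge0 // ltW.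
  apply/ltW/(lt_le_trans a2); rewrite -{2}(mul1r n%:R^-1) -mulrDl natr1.
  by rewrite ler_pdivrMr // mul1r ler_nat cell_coord_lt.
rewrite /cell_slot lebesgue_measure_itv /= lte_fin ltrDl nV -EFinB.
by rewrite addrAC subrr add0r.
Qed.

Lemma cell_event_measurable (d : measure_display) (Omega : measurableType d)
    (R : realType) (P : probability Omega R) (U : nat -> Omega -> R) n
    (f : 'I_n -> 'I_n * 'I_n) :
  (forall j, uniform01 P (U j)) -> measurable (cell_event U f).
Proof.
move=> unifU; rewrite cell_eventE; apply: fin_bigcap_measurable => // j _.
have [mU _] := unifU j.
rewrite -[X in measurable X]setTI; apply: mU => //; exact: cell_slot_measurable.
Qed.

Lemma prob_cell_event (d : measure_display) (Omega : measurableType d)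
    (R : realType) (P : probability Omega R) (U : nat -> Omega -> R) n
    (f : 'I_n -> 'I_n * 'I_n) :
  mutually_independent P U -> (forall j, uniform01 P (U j)) -> (0 < n)%N ->
  P (cell_event U f) = (#|{ffun 'I_n -> 'I_n * 'I_n}|%:R^-1 : R)%:E.
Proof.
move=> indepU unifU n0; rewrite cell_eventE indepU ?iota_uniq //; last first.
  by move=> j _; apply: cell_slot_measurable.
rewrite (eq_bigr (fun=> (n%:R^-1 : R)%:E)); last by move=> j _; apply: prob_cell_slot.
rewrite prode_const size_iota card_ffun card_prod !card_ord natrX natrM -expr2.
by rewrite -exprM exprVn.
Qed.

(** The cell events are disjoint and equally likely, so a probability becomes a proportion of cell
    maps. *)
Lemma prob_cell_events (d : measure_display) (Omega : measurableType d)
    (R : realType) (P : probability Omega R) (U : nat -> Omega -> R) n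
    (A : {set {ffun 'I_n -> 'I_n * 'I_n}}) :
  mutually_independent P U -> (forall j, uniform01 P (U j)) -> (0 < n)%N ->
  measurable (\bigcup_(f in [set` A]) cell_event U f) /\
  P (\bigcup_(f in [set` A]) cell_event U f) =
    (#|A|%:R / #|{ffun 'I_n -> 'I_n * 'I_n}|%:R : R)%:E.
Proof.
move=> indepU unifU n0; have finA : finite_set [set` A] by exact: finite_finset.
split; first by apply: fin_bigcup_measurable => // f _; apply: (cell_event_measurable _ unifU).
rewrite measure_fin_bigcup //; last by move=> f _; apply: (cell_event_measurable _ unifU).
  rewrite (_ : [set` A] = [set` enum A]); last first.
    by apply/seteqP; split=> f /=; rewrite mem_enum.
  rewrite -fsbig_seq ?enum_uniq //.
  rewrite (eq_bigr (fun=> (#|{ffun 'I_n -> 'I_n * 'I_n}|%:R^-1 : R)%:E)); last first.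
    by move=> f _; apply: prob_cell_event.
  by rewrite sumEFin big_const_seq count_predT iter_addr_0 -cardE mulr_natl.
move=> f g _ _ [w [fw gw]]; apply/ffunP => i.
exact: in_cell_inj n0 (fw i) (gw i).
Qed.

(** * The lower bound on the optimum *)

Lemma subseq_flatten_map (T : eqType) (g : seq T -> seq T) (p : pred (seq T))
    (S : seq (seq T)) :
  (forall t, subseq (g t) t) -> subseq (flatten [seq g t | t <- S & p t]) (flatten S).
Proof.
move=> hg; elim: S => //= t S IH; case: (p t) => /=; first exact: cat_subseq.
exact: subseq_trans IH (suffix_subseq _ _).
Qed.

(** Layer [i] gathers the [i]-th item of every [t] that has one. Applied to windows, a layer holds
    one per tour, hence disjoint paths. *)
Lemma sum_layers (R : realType) (T : eqType) (S : seq T) (m : T -> nat) (k : nat)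
    (F : T -> nat -> R) :
  (forall t, t \in S -> m t <= k)%N ->
  \sum_(0 <= i < k) \sum_(t <- S | (i < m t)%N) F t i =
  \sum_(t <- S) \sum_(0 <= i < m t) F t i.
Proof.
move=> mk; under eq_bigr do rewrite big_mkcond /=.
rewrite exchange_big /=; apply: eq_big_seq => t tS.
rewrite (@big_cat_nat _ _ _ (m t) 0 k) ?mk //= [X in _ + X]big1_seq ?addr0.
  by rewrite !big_nat; apply: eq_bigr => i /andP[_ ->].
by move=> i /andP[_]; rewrite mem_index_iota => /andP[h _]; rewrite ltnNge h.
Qed.

(** [t] belongs to the layers [m t <= j < k], which are [k - m t] in number. *)
Lemma sum_layers_ge (R : realType) (T : eqType) (S : seq T) (m : T -> nat) (k : nat) (F : T -> R) :
  (forall t, t \in S -> m t <= k)%N ->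
  \sum_(0 <= j < k) \sum_(t <- S | (m t <= j)%N) F t =
  \sum_(t <- S) (k%:R - (m t)%:R) * F t.
Proof.
move=> mk; have e : \sum_(0 <= j < k) \sum_(t <- S | (m t <= j)%N) F t +
   \sum_(0 <= j < k) \sum_(t <- S | (j < m t)%N) F t = \sum_(t <- S) k%:R * F t.
  rewrite -big_split /= -[RHS]mulr_sumr -[X in X%:R * _](subn0 k) mulr_natl -sumr_const_nat.
  apply: eq_bigr => j _; rewrite [RHS](bigID (fun t => (m t <= j)%N)) /=.
  by congr (_ + _); apply: eq_bigl => t; rewrite ltnNge.
move: e; rewrite (sum_layers (fun t _ => F t) mk).
under [X in _ + X = _ -> _]eq_bigr do rewrite sumr_const_nat subn0 -mulr_natl.
under [X in _ -> _ = X]eq_bigr do rewrite mulrBl.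
by rewrite sumrB => <-; rewrite addrK.
Qed.

Lemma sum_over_tours (R : realType) n (F : 'I_n -> R) (S : seq (seq 'I_n)) :
  perm_eq (flatten S) (enum 'I_n) ->
  \sum_(i < n) F i = \sum_(t <- S) \sum_(i <- t) F i.
Proof. by move=> eS; rewrite -big_flatten (perm_big _ eS) /= big_enum. Qed.

(* Tours with fewer than M points are dropped, so that the windows are few. *)
Lemma windows_ge (R : realType) n k (q M : R) (O : pt R) (V : 'I_n -> pt R)
    (S : seq (seq 'I_n)) :
  0 < q -> 0 < M -> spread_out q O V -> perm_eq (flatten S) (enum 'I_n) ->
  (forall t, t \in S -> (size t <= k)%N) ->
  \sum_(t <- S | M <= (size t)%:R) (size t)%:R ^+ 2 <=
  8 * q ^+ 2 * (\sum_(t <- S) \sum_(0 <= i < size t) path_length (map V (window t i))) +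
  k%:R * (8 * q * (n%:R / M + 1) + 12 * q ^+ 2).
Proof.
move=> q0 M0 sV eS szS; have uS : uniq (flatten S) by rewrite (perm_uniq eS) enum_uniq.
have q2 : 0 < q ^+ 2 by rewrite exprn_gt0.
pose p (t : seq 'I_n) := M <= (size t)%:R.
pose S' := [seq t <- S | p t].
have S'S : subseq (flatten S') (flatten S).
  have := @subseq_flatten_map _ id p S (fun t => subseq_refl t); by rewrite map_id.
have szS' t : t \in S' -> (size t <= k)%N by rewrite mem_filter => /andP[_ /szS].
have sumS : \sum_(t <- S) (size t)%:R = n%:R :> R.
  by rewrite -natr_size_flatten (perm_size eS) size_enum_ord.
have sS' : (size S')%:R <= n%:R / M.
  rewrite ler_pdivlMr // -sumS -(sum1_size S') natr_sum mulr_suml.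
  rewrite /S' big_filter [leRHS](bigID p) /=; apply: ler_wpDr.
    by apply: sumr_ge0.
  by apply: ler_sum => t; rewrite mul1r.
(* One window per tour, with more than half of its points, whence the doubling of the constants of
   [spread_free]; there are at most [n / M] windows. *)
have layer i : \sum_(t <- S' | (i < size t)%N) (size t)%:R <=
    8 * q ^+ 2 * (\sum_(t <- S' | (i < size t)%N) path_length (map V (window t i))) +
    (8 * q * (n%:R / M + 1) + 12 * q ^+ 2).
  pose ws := [seq window t i | t <- S' & (i < size t)%N].
  have uws : uniq (flatten ws).
    apply: subseq_uniq uS; apply: subseq_trans S'S.
    apply: (@subseq_flatten_map _ (fun t => window t i)) => t; exact: subseq_window.
  have := spread_free sV uws; rewrite natr_size_flatten !big_map !big_filter /=.
  have : (size ws)%:R <= n%:R / M.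
    apply: le_trans sS'; rewrite ler_nat size_map size_filter; exact: count_size.
  have : \sum_(t <- S' | (i < size t)%N) (size t)%:R <=
    2 * \sum_(t <- S' | (i < size t)%N) (size (window t i))%:R :> R.
    rewrite mulr_sumr; apply: ler_sum => t /size_window h.
    by rewrite -natrM ler_nat mul2n ltnW.
  move=> h1 /(ler_wpM2l (ltW q0)) h2 h3; move: h1 h2 h3; clear.
  move: (n%:R / M) ((size ws)%:R) (q ^+ 2) => a b q2.
  move: (\sum_(t <- S' | _) _) (\sum_(t <- S' | _) _) (\sum_(t <- S' | _) _) => A B C.
  lra.
have h : \sum_(0 <= i < k) \sum_(t <- S' | (i < size t)%N) (size t)%:R <=
   \sum_(0 <= i < k) (8 * q ^+ 2 *
      (\sum_(t <- S' | (i < size t)%N) path_length (map V (window t i))) +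
      (8 * q * (n%:R / M + 1) + 12 * q ^+ 2)) by apply: ler_sum => i _; apply: layer.
move: h; rewrite big_split /= -mulr_sumr (sum_layers (fun t _ => (size t)%:R) szS').
rewrite (sum_layers (fun t i => path_length (map V (window t i))) szS').
rewrite sumr_const_nat subn0 -(mulr_natl (_ + 12 * _)).
have -> : \sum_(t <- S') \sum_(0 <= i < size t) (size t)%:R =
    \sum_(t <- S') (size t)%:R ^+ 2 :> R.
  by apply: eq_bigr => t _; rewrite sumr_const_nat subn0 expr2 mulr_natr.
rewrite big_filter => h; apply: le_trans h _; rewrite lerD2r.
rewrite ler_pM2l ?mulr_gt0 // big_filter [leRHS](bigID p) /= lerDl.
by apply: sumr_ge0 => t _; apply: sumr_ge0 => i _; apply: path_length_ge0.
Qed.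

(** [spread_rooted] for the tours with at most [j] points, added up over [j < k]; the last leg back
    to the depot is given away. *)
Lemma underfull_tours_ge (R : realType) n k (q : R) (O : pt R) (V : 'I_n -> pt R)
    (S : seq (seq 'I_n)) :
  spread_out q O V -> perm_eq (flatten S) (enum 'I_n) ->
  (forall t, t \in S -> (size t <= k)%N) ->
  \sum_(t <- S) (k%:R - (size t)%:R) * (size t)%:R <=
  8 * q ^+ 2 * (\sum_(t <- S) (k%:R - (size t)%:R) * route_cost O (map V t)) +
  k%:R * (4 * q + 12 * q ^+ 2).
Proof.
move=> sV eS szS; have uS : uniq (flatten S) by rewrite (perm_uniq eS) enum_uniq.
rewrite -!(sum_layers_ge _ szS) mulr_sumr.
rewrite (_ : k%:R * _ = \sum_(0 <= j < k) (4 * q + 12 * q ^+ 2)); last first.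
  by rewrite sumr_const_nat subn0 mulr_natl.
rewrite -big_split /=; apply: ler_sum => j _.
pose ws := [seq t <- S | (size t <= j)%N].
have uws : uniq (flatten ws).
  apply: subseq_uniq uS.
  have := @subseq_flatten_map _ id (fun t => (size t <= j)%N) S (fun t => subseq_refl t).
  by rewrite map_id.
have := spread_rooted sV uws; rewrite natr_size_flatten !big_filter addrA => h.
apply: le_trans h _; rewrite !lerD2r; apply: ler_wpM2l.
  by apply: mulr_ge0; rewrite ?sqr_ge0.
by apply: ler_sum => t _; apply: pathlen_le_route_cost.
Qed.

(** Of [k] copies of a tour with [m] points, [m] are compared with its windows and [k - m] with
    rooted paths. The counts [m ^ 2] and [(k - m) * m] add up to [k * m], in total [k * n]. *)
Lemma savings (R : realType) n k (q M : R) (O : pt R) (V : 'I_n -> pt R)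
    (S : seq (seq 'I_n)) :
  0 < q -> 0 < M -> spread_out q O V -> perm_eq (flatten S) (enum 'I_n) ->
  (forall t, t \in S -> (size t <= k)%N) ->
  k%:R * n%:R - M * n%:R - k%:R * (12 * q + 24 * q ^+ 2 + 8 * q * (n%:R / M)) <=
  8 * q ^+ 2 * (k%:R * (\sum_(t <- S) route_cost O (map V t)) -
    2 * \sum_(i < n) edist O (V i)).
Proof.
move=> q0 M0 sV eS szS.
have h1 := windows_ge q0 M0 sV eS szS; have h2 := underfull_tours_ge sV eS szS.
have sumS : \sum_(t <- S) (size t)%:R = n%:R :> R.
  by rewrite -natr_size_flatten (perm_size eS) size_enum_ord.
have sumd : \sum_(i < n) edist O (V i) = \sum_(t <- S) \sum_(i <- t) edist O (V i).
  exact: sum_over_tours.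
have h3 : \sum_(t <- S) \sum_(0 <= i < size t) path_length (map V (window t i)) +
    2 * \sum_(i < n) edist O (V i) <= \sum_(t <- S) (size t)%:R * route_cost O (map V t).
  rewrite sumd mulr_sumr -big_split /=; apply: ler_sum => t _.
  have := sum_window_le O (map V t); rewrite size_map big_map.
  have -> // : \sum_(0 <= i < size t) path_length (map V (window t i)) =
    \sum_(0 <= i < size t) path_length (window (map V t) i).
  by apply: eq_bigr => i _; rewrite window_map.
have h4 : \sum_(t <- S) (k%:R - (size t)%:R) * route_cost O (map V t) =
  k%:R * (\sum_(t <- S) route_cost O (map V t)) -
  \sum_(t <- S) (size t)%:R * route_cost O (map V t).
  by rewrite mulr_sumr -sumrB; apply: eq_bigr => t _; rewrite mulrBl.
have h5 : \sum_(t <- S) (k%:R - (size t)%:R) * (size t)%:R =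
  k%:R * n%:R - \sum_(t <- S) (size t)%:R ^+ 2 :> R.
  by rewrite -sumS mulr_sumr -sumrB; apply: eq_bigr => t _; rewrite mulrBl expr2.
(* A tour of [m < M] points, left out of the window bound, has [m ^ 2 <= M * m]; this is the loss
   [M * n]. *)
have h6 : \sum_(t <- S) (size t)%:R ^+ 2 <=
  \sum_(t <- S | M <= (size t)%:R) (size t)%:R ^+ 2 + M * n%:R :> R.
  rewrite (bigID (fun t => M <= (size t)%:R)) /= lerD2l -sumS mulr_sumr.
  rewrite [leRHS](bigID (fun t => M <= (size t)%:R)) /=; apply: ler_wpDl.
    by apply: sumr_ge0 => t _; rewrite mulr_ge0 // ltW.
  by apply: ler_sum => t; rewrite -ltNge => /ltW h; rewrite expr2 ler_wpM2r.
have q2 : 0 <= 8 * q ^+ 2 by rewrite mulr_ge0 ?sqr_ge0.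
have h7 := ler_wpM2l q2 h3; rewrite h4 h5 in h2.
move: h1 h2 h6 h7; clear.
move: (\sum_(t <- S) \sum_(0 <= i < size t) _) (\sum_(i < n) _) => A B.
move: (\sum_(t <- S) _ * _) (\sum_(t <- S) route_cost _ _) => C D.
move: (\sum_(t <- S | _) _) (\sum_(t <- S) _) => E F.
lra.
Qed.

Lemma cvrp_cost_lower (R : realType) n k (q : R) (O : pt R) (V : 'I_n -> pt R)
    (S : seq (seq 'I_n)) :
  500 * 500 <= q -> 10 + 2 * `|O.1| + 2 * `|O.2| <= q -> q ^+ 4 = n%:R -> (0 < k)%N ->
  (forall i, 0 <= (V i).1 <= 1 /\ 0 <= (V i).2 <= 1) ->
  spread_out q O V -> perm_eq (flatten S) (enum 'I_n) ->
  (forall t, t \in S -> (size t <= k)%N) ->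
  let C := \sum_(t <- S) route_cost O (map V t) in
  tsp_opt O V <= C /\
  2 / k%:R * (\sum_(i < n) edist O (V i)) + tsp_opt O V <= (1 + 183 / 200) * C.
Proof.
move=> q1 qc qn k0 V01 sV eS szS C.
have kR : 0 < k%:R :> R by rewrite ltr0n.
have q0 : 0 < q by lra.
set B := \sum_(i < n) _; set T := tsp_opt O V.
have TC : T <= C.
  apply: le_trans (tsp_opt_le_seq O V eS) _.
  rewrite map_flatten; apply: le_trans (route_cost_flatten _ _) _.
  by rewrite /routes_cost big_map.
split=> //.
have B0 : 0 <= B by apply: sumr_ge0 => i _; apply: edist_ge0.
have C0 : 0 <= C by apply: sumr_ge0 => t _; apply: route_cost_ge0.
(* From [sum_window_le], with the windows dropped and [size t <= k]. *)
have RC : 2 / k%:R * B <= C.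
  rewrite mulrAC ler_pdivrMr // mulrC.
  rewrite /B (sum_over_tours _ eS) mulr_suml mulr_suml.
  rewrite big_seq [leRHS]big_seq; apply: ler_sum => t tS.
  have := sum_window_le O (map V t); rewrite size_map big_map => h.
  apply: le_trans (_ : (size t)%:R * route_cost O (map V t) <= _); last first.
    by rewrite mulrC ler_wpM2l ?route_cost_ge0 // ler_nat szS.
  apply: le_trans h; rewrite mulrC lerDr.
  by apply: sumr_ge0 => i _; apply: path_length_ge0.
have TQ : T <= 99 / 70 * q ^+ 2 + q.
  have := tsp_opt_unit_square O (fun i => (V01 i).1) (fun i => (V01 i).2).
  rewrite -qn (_ : q ^+ 4 = (q ^+ 2) ^+ 2); last by ring.
  rewrite sqrtr_sqr ger0_norm ?sqr_ge0 // -/T; move: qc; clear; lra.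
set X := 2 / k%:R * B in RC *.
have kX : k%:R * X = 2 * B by rewrite /X mulrA mulrCA divff ?gt_eqF // mulr1.
have X0 : 0 <= X by rewrite mulr_ge0 // divr_ge0 // ltW.
pose Q := q ^+ 2; have Qq : 500 * 500 * q <= Q by rewrite /Q expr2 ler_wpM2r // ltW.
have nQ : n%:R = Q * Q by rewrite -qn /Q; ring.
have Q0 : 0 < Q by rewrite exprn_gt0.
have [kq|kq] := lerP (100 * (500 * q)) k%:R.
  (* Large [k]: with [M = 500 * q] the losses are 1/100 and 8/500 of the main term, so [C - X] is at
     least [487/4000 * Q] up to a constant, and 487/4000 exceeds 0.085 times 99/70. *)
  have M0 : 0 < 500 * q by move: q0; clear; lra.
  have := savings q0 M0 sV eS szS.
  rewrite -/C -/Q -/B -kX -mulrBr.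
  have -> : 8 * q * (n%:R / (500 * q)) = 8 / 500 * (Q * Q).
    by rewrite nQ; field; rewrite gt_eqF.
  have : 500 * q * n%:R <= k%:R * (n%:R / 100).
    rewrite (_ : 500 * q * n%:R = 100 * (500 * q) * (n%:R / 100)); last by field.
    by rewrite ler_wpM2r // divr_ge0.
  rewrite nQ => h1 h2.
  have h3 : k%:R * (Q * Q - Q * Q / 100 - (12 * q + 24 * Q + 8 / 500 * (Q * Q))) <=
     k%:R * (8 * Q * (C - X)) by lra.
  rewrite ler_pM2l // in h3.
  have h4 : Q * (Q - Q / 100 - 25 - 8 / 500 * Q) <= Q * (8 * (C - X)) by lra.
  rewrite ler_pM2l // in h4.
  rewrite -/Q in TQ; move: TQ TC RC h4 Qq q1; clear; lra.
(* Small [k]: the mean distance from the depot is at least nearly 1/4, so [X] is at least nearly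
   [5/2 * Q], and 183/200 of it already exceeds the bound on [T]. *)
have := spread_depot sV; rewrite -/B nQ => h.
have h1 : 2 * B <= 100 * (500 * q) * X by rewrite -kX ler_wpM2r // ltW.
have h2 := ler_wpM2r (ltW Q0) Qq.
have h3 : q * (500 * 500 * Q) <= q * (2 * (100 * 500) * X + 5).
  by move: h h1 h2 q1; clear; lra.
rewrite ler_pM2l // in h3; rewrite -/Q in TQ; move: TQ TC RC h3 Qq q1; clear; lra.
Qed.

(** * The approximation ratio, asymptotically almost surely *)

Lemma nonempty_feasible (R : realType) n (O : pt R) (V : 'I_n -> pt R) k : (0 < k)%N ->
  [set c : R | exists tours : seq (seq 'I_n),
        [/\ (forall t, t \in tours -> size (undup t) <= k)%N,
            (forall i : 'I_n, exists2 t, t \in tours & i \in t) &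
            c = \sum_(t <- tours) route_cost O [seq V j | j <- t]]] !=set0.
Proof.
move=> k0; pose S := [seq [:: i] | i <- enum 'I_n].
exists (\sum_(t <- S) route_cost O (map V t)); exists S; split=> // [t|i].
  by case/mapP=> i _ ->.
by exists [:: i]; rewrite ?inE // map_f // mem_enum.
Qed.

Lemma ITP_le_cvrp_opt (R : realType) n k (q alpha : R) (O : pt R) (V : 'I_n -> pt R) T :
  500 * 500 <= q -> 10 + 2 * `|O.1| + 2 * `|O.2| <= q -> q ^+ 4 = n%:R -> (0 < k)%N ->
  (forall i, 0 <= (V i).1 <= 1 /\ 0 <= (V i).2 <= 1) ->
  spread_out q O V -> 1 <= alpha -> alpha_approx alpha O V T ->
  ITP O V k T <= (183 / 200 + alpha) * cvrp_opt O V k.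
Proof.
move=> q1 qc qn k0 V01 sV a1 aT.
have a0 : 0 < 183 / 200 + alpha by lra.
rewrite mulrC -ler_pdivrMr //; apply: lb_le_inf; first exact: nonempty_feasible.
move=> c [tours [szk cov ->]]; have [S [eS szS cS]] := disjoint_tours O V szk cov.
have /= := cvrp_cost_lower q1 qc qn k0 V01 sV eS szS.
set C := \sum_(t <- S) _ in cS *; case=> TC h; apply: le_trans cS.
rewrite ler_pdivrMr // mulrC; apply: le_trans (ITP_le O V T k0) _.
move: aT; rewrite /alpha_approx; set t := tsp_opt O V in TC h *; set r := _ * _ in h *.
(* The bound on [r + t] covers [alpha = 1]; the excess [(alpha - 1) * t] is at most
   [(alpha - 1) * C]. *)
move=> aT; have : (alpha - 1) * t <= (alpha - 1) * C by rewrite ler_wpM2l // subr_ge0.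
lra.
Qed.

Lemma sqrt_sqrt_pow4 (R : realType) n : Num.sqrt (Num.sqrt n%:R) ^+ 4 = n%:R :> R.
Proof. by rewrite (exprM _ 2 2) !sqr_sqrtr ?sqrtr_ge0. Qed.

Lemma sqrt_sqrt_ge (R : realType) (K : R) :
  \forall n \near \oo, K <= Num.sqrt (Num.sqrt n%:R).
Proof.
near=> n; have h : (K ^+ 2) ^+ 2 <= n%:R by near: n; exact: nbhs_infty_ger.
apply: le_of_sqr; rewrite ?sqrtr_ge0 // sqr_sqrtr ?sqrtr_ge0 //.
by apply: le_of_sqr; rewrite ?sqrtr_ge0 // sqr_sqrtr.
Unshelve. all: by end_near.
Qed.

Theorem theorem2 (R : realType) (d : measure_display) (Omega : measurableType d)
    (P : probability Omega R) (U : nat -> Omega -> R)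
    (alpha : R) (O : pt R) (kf : nat -> nat) :
  mutually_independent P U ->
  (forall j, uniform01 P (U j)) ->
  1 <= alpha ->
  (forall n, (0 < n)%N -> (1 <= kf n <= n)%N) ->
  exists E : nat -> set Omega,
    [/\ (forall n, measurable (E n)),
        (forall n w, E n w ->
           forall T : {perm 'I_n},
             alpha_approx alpha O (random_points U n w) T ->
             ITP O (random_points U n w) (kf n) T <=
               (915%:R / 1000%:R + alpha) *
               cvrp_opt O (random_points U n w) (kf n)) &
        (fun n => P (E n)) @ \oo --> 1%E].
Proof.
move=> indepU unifU a1 kfP.
pose q (n : nat) : R := Num.sqrt (Num.sqrt n%:R).
pose large n := 500 * 500 <= q n /\ 10 + 2 * `|O.1| + 2 * `|O.2| <= q n.
have ex n : exists E : set Omega, [/\ measurable E,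
    (forall w, E w -> forall T, alpha_approx alpha O (random_points U n w) T ->
      ITP O (random_points U n w) (kf n) T <=
      (183 / 200 + alpha) * cvrp_opt O (random_points U n w) (kf n)) &
    large n -> ((1 - (q n)^-1)%:E <= P E)%E].
  (* For the finitely many small [n] the empty event will do. *)
  have [[l1 l2]|nl] := pselect (large n); last by exists set0.
  have q0 : 0 < q n by lra.
  have q100 : 100 <= q n by lra.
  have qn : q n ^+ 4 = n%:R := sqrt_sqrt_pow4 R n.
  have n0 : (0 < n)%N by rewrite -(ltr0n R) -qn exprn_gt0.
  have [A [cA spreadA]] := most_cells_spread_out O q100 qn.
  have [mE pE] := prob_cell_events A indepU unifU n0.
  exists (\bigcup_(f in [set` A]) cell_event U f); split=> //.
    move=> w [f /= fA fw] T; apply: ITP_le_cvrp_opt l1 l2 qn _ _ _ a1.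
    - by case/andP: (kfP n n0).
    - by move=> i; apply: in_cell_unit n0 (fw i).
    - exact: spreadA fA _ fw.
  move=> _; rewrite pE lee_fin.
  set F := #|{ffun _}|; have F0 : 0 < F%:R :> R.
    by rewrite ltr0n /F card_ffun card_prod !card_ord expn_gt0 muln_gt0 n0.
  have eF : #|A|%:R + #|~: A|%:R = F%:R :> R by rewrite -natrD cardsC.
  rewrite ler_pdivlMr // mulrBl mul1r -eF lerBlDr lerD2l eF.
  by rewrite ler_pdivlMl // mulrC.
have [E hE] := choice ex.
exists E; split=> [n|n w Ew T aT|]; first by have [] := hE n.
  have [_ h _] := hE n; have -> : 915%:R / 1000%:R = 183 / 200 :> R by lra.
  exact: h.
apply/fine_cvgP; split.
  by apply: nearW => n; apply: fin_num_measure; have [] := hE n.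
(* The probability lies between [1 - 1 / q n] and 1, and [q n] tends to infinity. *)
apply/cvgrPdist_le => eps eps0; near=> n.
have lq : large n by split; near: n; exact: sqrt_sqrt_ge.
have [mE _ /(_ lq) pE] := hE n.
have : (P (E n) <= 1)%E by exact: probability_le1.
move: pE; rewrite -[P (E n)]fineK ?fin_num_measure // !lee_fin /= => p1 p2.
rewrite ger0_norm ?subr_ge0 //.
have : (q n)^-1 <= eps; last lra.
have q0 : 0 < q n by case: lq => l1 _; lra.
rewrite -[eps]invrK lef_pV2 ?posrE ?invr_gt0 //.
by near: n; exact: sqrt_sqrt_ge.
Unshelve. all: by end_near.
Qed.
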